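(* Let $\lambda,\mu,\nu$ be partitions and let $n$ be a positive integer such that $\lambda,\mu,\nu$ each have at most $n$ rows. Define the Littlewood--Richardson polynomial $c^{\nu}_{\lambda\mu}(a)\in\mathbb{Z}[a]$ as the coefficient of $s_\nu(x\,\|\,a)$ in the expansion $$s_\lambda(x\,\|\,a)\,s_\mu(x\,\|\,a)=\sum_{\nu}c^{\nu}_{\lambda\mu}(a)\,s_\nu(x\,\|\,a),\qquad x=(x_1,\dots,x_n),$$ the sum being over partitions $\nu$ with at most $n$ rows. Then $c^{\nu}_{\lambda\mu}(a)=0$ unless $\mu\subseteq\nu$, and if $\mu\subseteq\nu$ then $$c^{\nu}_{\lambda\mu}(a)=\sum_R\sum_T\prod_{\substack{\alpha\in\lambda\\ T(\alpha)\text{ unbarred}}}\Big(a_{T(\alpha)-\rho(\alpha)_{T(\alpha)}}-a_{T(\alpha)-c(\alpha)}\Big),$$ where $R$ runs over all sequences of diagrams $\mu=\rho^{(0)}\to\rho^{(1)}\to\dots\to\rho^{(l)}=\nu$ and $T$ runs over all $\nu$-bounded barred reverse $\lambda$-tableaux in $\mathcal{T}(\lambda,R)$. Moreover, for every factor occurring in this formula one has $\rho(\alpha)_{T(\alpha)}>c(\alpha)$.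
   Context: $a=(a_i)_{i\in\mathbb{Z}}$ is a sequence of independent variables. Partitions are identified with their Young diagrams (left-justified rows of boxes, $\lambda_1$ boxes in the top row, etc.); box $(i,j)$ is in row $i$, column $j$; its content is $c(\alpha)=j-i$. $\lambda'$ denotes the transposed diagram, so $\lambda'_j$ is the length of column $j$. A reverse $\lambda$-tableau with entries in $\{1,\dots,n\}$ is a filling $T$ of the boxes of $\lambda$ whose entries weakly decrease along rows (left to right) and strictly decrease down columns; $T(\alpha)$ is the entry in box $\alpha$. The double Schur polynomial is $$s_\lambda(x\,\|\,a)=\sum_T\prod_{\alpha\in\lambda}\big(x_{T(\alpha)}-a_{T(\alpha)-c(\alpha)}\big),$$ summed over reverse $\lambda$-tableaux $T$ with entries in $\{1,\dots,n\}$; the $s_\lambda(x\|a)$ with $\lambda$ having at most $n$ rows form a $\mathbb{Z}[a]$-basis of the ring of symmetric polynomials in $x_1,\dots,x_n$ over $\mathbb{Z}[a]$. Notation $\rho\to\sigma$ means $\sigma$ is obtained from diagram $\rho$ by adding one box. For a sequence $R:\ \mu=\rho^{(0)}\to\rho^{(1)}\to\dots\to\rho^{(l)}=\nu$, let $r_i$ be the row number of the box added to $\rho^{(i-1)}$ to get $\rho^{(i)}$; $r_1r_2\cdots r_l$ is the Yamanouchi symbol of $R$. The column order on the boxes of $\lambda$: boxes are read column by column from left to right, and within each column from bottom to top; write $\alpha\prec\beta$ if $\alpha$ strictly precedes $\beta$. $\mathcal{T}(\lambda,R)$ is the set of pairs consisting of a reverse $\lambda$-tableau $T$ (entries positive integers)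 together with a choice of boxes $\alpha_1\prec\alpha_2\prec\dots\prec\alpha_l$ with $T(\alpha_i)=r_i$ for all $i$; the entries in $\alpha_1,\dots,\alpha_l$ are called barred, the others unbarred. For a box $\alpha$ with $\alpha_i\prec\alpha\prec\alpha_{i+1}$ ($0\le i\le l$, where conditions involving $\alpha_0$ or $\alpha_{l+1}$ are void), set $\rho(\alpha)=\rho^{(i)}$, and $\rho(\alpha)_k$ denotes the length of row $k$ of this diagram. A reverse $\lambda$-tableau $T$ is $\nu$-bounded if $T(1,j)\le\nu'_j$ for all $j=1,\dots,\lambda_1$. *)

(* Defs.v *)
From HB Require Import structures.
From mathcomp Require Import all_boot all_order all_algebra.
Set Implicit Arguments. Unset Strict Implicit. Unset Printing Implicit Defensive.
Import Order.TTheory GRing.Theory Num.Theory.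

Definition is_partition (p : seq nat) : bool :=
  sorted geq p && all (fun x => 0 < x) p.

(* length of row k (rows numbered from 1); 0 beyond the last row *)
Definition part (p : seq nat) (k : nat) : nat := nth 0 p k.-1.

Definition conj_part (p : seq nat) (j : nat) : nat := count (fun x => j <= x) p.

(* box (i,j) : row i, column j, both 1-indexed *)
Definition box := (nat * nat)%type.

Definition in_diag (p : seq nat) (b : box) : bool :=
  (1 <= b.1 <= size p) && (1 <= b.2 <= part p b.1).

Definition content (b : box) : int := (b.2%:Z - b.1%:Z)%R.

(* The boxes of p listed in the column order: columns left to right,
   within each column from bottom to top. *)
Definition boxes (p : seq nat) : seq box :=
  flatten [seq [seq (i, j) | i <- rev (iota 1 (conj_part p j))]
          | j <- iota 1 (part p 1)].

Definition subdiag (mu nu : seq nat) : bool :=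
  all (fun k => part mu k <= part nu k) (iota 1 (size mu)).

Fixpoint words (N K : nat) : seq (seq nat) :=
  if N is N'.+1 then [seq x :: w | x <- iota 1 K, w <- words N' K] else [:: [::]].

Fixpoint bwords (N : nat) : seq (seq bool) :=
  if N is N'.+1 then [seq b :: w | b <- [:: true; false], w <- bwords N'] else [:: [::]].

Definition parts_upto (n B : nat) : seq (seq nat) :=
  flatten [seq [seq p <- words k B | is_partition p && (sumn p <= B)] | k <- iota 0 n.+1].

Definition reverse_tab (p : seq nat) (T : box -> nat) : bool :=
  all (fun b => 0 < T b) (boxes p) &&
  all (fun b => (in_diag p (b.1, b.2.+1) ==> (T (b.1, b.2.+1) <= T b)) &&
                (in_diag p (b.1.+1, b.2) ==> (T (b.1.+1, b.2) < T b))) (boxes p).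

Definition tab_of (p : seq nat) (t : seq nat) : box -> nat :=
  fun b => nth 0 t (index b (boxes p)).

Definition nu_bounded (lam nu : seq nat) (T : box -> nat) : bool :=
  all (fun j => T (1, j) <= conj_part nu j) (iota 1 (part lam 1)).

Definition add_box (p : seq nat) (k : nat) : seq nat := incr_nth p k.-1.

(* The sequence of diagrams rho^(0) = mu, rho^(1), ..., rho^(l) determined
   by the Yamanouchi symbol r = r_1 ... r_l (row numbers of the added boxes). *)
Definition rho_seq (mu : seq nat) (r : seq nat) : seq (seq nat) :=
  mu :: scanl add_box mu r.

Definition yam_ok (mu nu : seq nat) (r : seq nat) : bool :=
  all is_partition (scanl add_box mu r) && (last mu (scanl add_box mu r) == nu).

(* The chosen barred boxes alpha_1 < ... < alpha_l (column order) are those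
   selected by the mask m; require T(alpha_i) = r_i. *)
Definition barred_ok (lam : seq nat) (r : seq nat) (T : box -> nat) (m : seq bool) : bool :=
  (size m == size (boxes lam)) && ([seq T b | b <- mask m (boxes lam)] == r).

(* rho(alpha) for the box of index k in the column order: rho^(i) where i is
   the number of barred boxes strictly preceding it. *)
Definition rho_of (mu r : seq nat) (m : seq bool) (k : nat) : seq nat :=
  nth [::] (rho_seq mu r) (count id (take k m)).

Definition dschur (R : comPzRingType) (n : nat) (p : seq nat)
    (x : nat -> R) (a : int -> R) : R :=
  (\sum_(t <- words (size (boxes p)) n | reverse_tab p (tab_of p t))
     \prod_(b <- boxes p)
        (x (tab_of p t b) - a ((tab_of p t b)%:Z - content b)))%R.

(* The combinatorial formula for c^nu_{lam mu}(a): sum over R (encoded by its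
   Yamanouchi symbol r) and over nu-bounded barred reverse lam-tableaux in
   T(lam, R).  Entries of a nu-bounded reverse tableau are at most
   T(1,1) <= nu'_1 = size nu, so enumerating entries in {1..size nu} loses
   nothing. 0 unless mu ⊆ nu. *)
Definition LRformula (R : comPzRingType) (lam mu nu : seq nat) (a : int -> R) : R :=
  if subdiag mu nu then
  (\sum_(r <- words (sumn nu - sumn mu) (size nu) | yam_ok mu nu r)
   \sum_(t <- words (size (boxes lam)) (size nu) |
          reverse_tab lam (tab_of lam t) && nu_bounded lam nu (tab_of lam t))
   \sum_(m <- bwords (size (boxes lam)) | barred_ok lam r (tab_of lam t) m)
   \prod_(k <- iota 0 (size (boxes lam)) | ~~ nth false m k)
     (let b := nth (0%N, 0%N) (boxes lam) k in
      let e := tab_of lam t b in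
      a (e%:Z - (part (rho_of mu r m k) e)%:Z) - a (e%:Z - content b)))%R
  else 0%R.

(* Main.v *)
Require Import Defs.
From HB Require Import structures.
From mathcomp Require Import all_boot all_order all_fingroup all_algebra.
From mathcomp Require Import zify ring.
Import Order.TTheory GRing.Theory Num.Theory.
Set Implicit Arguments. Unset Strict Implicit. Unset Printing Implicit Defensive.

(** Stembridge's cancellation argument, with parameters.  Attach to a diagram
    [rho] the polynomial [e_rho = prod_t (x_t - a_n)(x_t - a_(n-1))...] with
    [rho_t + n - t] factors for [x_t].  Then
      [(x_t - a_i) e_rho = e_(rho + box in row t) + (a_(t - rho_t) - a_i) e_rho],
    so multiplying [e_mu] by the factors of a tableau, in the column order,
    produces the barred tableaux and their weights.  After antisymmetrisation
    in [x], the walks leaving the set of diagrams cancel: at the first bad step,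
    which adds a box to row [t] when [rho_(t-1) = rho_t], the remaining sum is
    symmetric in [x_(t-1), x_t], by a Bender-Knuth type lemma for the tableaux
    whose preceding column is prescribed.  Hence [s_lambda A(e_mu)] is the sum of
    the [A(e_nu)] weighted by barred tableaux.

    A term whose tableau is not nu-bounded has a vanishing factor in the first
    row, and for nu-bounded tableaux every unbarred box in column [j] satisfies
    [rho(alpha)_(T(alpha)) >= j].  For empty [mu] this leaves no unbarred box, so
    [s_lambda A(e_0) = A(e_lambda)]; it remains to cancel the Vandermonde
    factor [A(e_0)]. *)

(** * Words, partitions and boxes *)

Lemma mem_words N K w :
  (w \in words N K) = (size w == N) && all (fun t => 0 < t <= K) w.
Proof.
elim: N w => [|N IH] [|y w] //=.
  by apply/negP => /allpairsP [[u v] /= [_ _ //]].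
apply/allpairsP/idP => [[[u v] /= [hu hv [-> ->]]]|/andP[hs /andP[hy hw]]].
  by move: hv hu; rewrite IH mem_iota => /andP[/eqP -> ->] hu; rewrite eqxx andbT /=; lia.
exists (y, w); split=> //=; first by rewrite mem_iota; lia.
by rewrite IH hw andbT.
Qed.

Lemma uniq_words N K : uniq (words N K).
Proof.
elim: N => [|N IH] //=.
by apply: allpairs_uniq => //; [exact: iota_uniq|move=> [u v] [u' v'] /= _ _ [-> ->]].
Qed.

Lemma mem_bwords N m : (m \in bwords N) = (size m == N).
Proof.
elim: N m => [|N IH] [|b m] //=.
  by apply/negP; rewrite mem_cat cats0 => /orP[] /mapP[].
rewrite cats0 mem_cat eqSS -IH.
apply/orP/idP => [[] /mapP [w hw [_ ->]] //|hm].
by case: b; [left|right]; apply/mapP; exists m.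
Qed.

Lemma uniq_bwords N : uniq (bwords N).
Proof.
elim: N => [|N IH] //=; rewrite cats0 cat_uniq !map_inj_uniq ?IH ?andbT /=.
- by apply/hasPn => w /mapP [v _ ->]; apply/negP => /mapP [].
- by move=> u v [].
- by move=> u v [].
Qed.

Lemma part_add_box p t u : 0 < t -> 0 < u ->
  part (add_box p t) u = part p u + (t == u).
Proof.
case: t u => [|t] [|u] // _ _; rewrite /part /add_box /= nth_incr_nth addnC.
by rewrite eqSS.
Qed.

Lemma part_foldl p s u : 0 < u -> all (fun t => 0 < t) s ->
  part (foldl add_box p s) u = part p u + count_mem u s.
Proof.
move=> hu; elim: s p => [|t s IH] p /=; first by rewrite addn0.
by case/andP=> ht hs; rewrite IH // part_add_box // addnA.
Qed.

Lemma sumn_add_box p t : sumn (add_box p t) = (sumn p).+1.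
Proof.
rewrite /add_box; elim: p t.-1 => [|y p IH] [|k] //=; last by rewrite IH addnS.
by elim: k => //= k; rewrite !add0n.
Qed.

Lemma sumn_foldl p s : sumn (foldl add_box p s) = sumn p + size s.
Proof. by elim: s p => [|t s IH] p /=; rewrite ?addn0 // IH sumn_add_box addSnnS. Qed.

Lemma size_foldl_le n p s : size p <= n -> all (fun t => 0 < t <= n) s ->
  size (foldl add_box p s) <= n.
Proof.
elim: s p => [|t s IH] p //= hp /andP[ht hs]; apply: IH => //.
by rewrite /add_box size_incr_nth; case: ifP => _ //; lia.
Qed.

Lemma is_partitionP p : reflect
  ((forall k, 0 < k -> part p k.+1 <= part p k) /\ 0 \notin p) (is_partition p).
Proof.
have h0 : all (fun x => 0 < x) p = (0 \notin p).
  by elim: p => //= x p ->; rewrite inE negb_or eq_sym lt0n.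
rewrite /is_partition h0; apply: (iffP andP) => -[hs h]; split=> //.
  move=> [|k] // _; rewrite /part /=.
  case: (ltnP k.+1 (size p)) => hk; last by rewrite nth_default.
  by have /(sortedP 0) := hs; apply.
by apply/(sortedP 0) => i hi; apply: (hs i.+1).
Qed.

Lemma part_homo p : is_partition p -> forall k l, 0 < k -> k <= l -> part p l <= part p k.
Proof.
move=> /is_partitionP [h _] k l hk; elim: l => [|l IH]; first by case: k hk.
rewrite leq_eqVlt ltnS => /orP[/eqP -> //|hl].
by apply: leq_trans (IH hl); apply: h; lia.
Qed.

Lemma part_pos p k : is_partition p -> 0 < k -> (0 < part p k) = (k <= size p).
Proof.
move=> /is_partitionP [_ h0]; case: k => // k _; rewrite /part /=.
case: (ltnP k (size p)) => hk; last by rewrite nth_default.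
by rewrite lt0n; apply: contra h0 => /eqP <-; apply: mem_nth.
Qed.

Lemma part_inj p q : is_partition p -> is_partition q ->
  (forall k, 0 < k -> part p k = part q k) -> p = q.
Proof.
move=> hp hq h.
have le p' q' : is_partition p' -> is_partition q' ->
   (forall k, 0 < k -> part p' k = part q' k) -> size p' <= size q'.
  move=> hp' hq' h'; case: (posnP (size p')) => [-> //|s0].
  by rewrite -(part_pos hq') // -h' // part_pos.
apply: (@eq_from_nth _ 0) => [|i hi].
  by apply/eqP; rewrite eqn_leq !le // => k hk; rewrite h.
exact: (h i.+1).
Qed.

(** Only the inequality between rows [t-1] and [t] can break. A box placed further below the diagram
    fits this too: both rows are then empty, and the padding zeros violate positivity. *)
Lemma not_partition_add_box p t : is_partition p -> 0 < t ->
  ~~ is_partition (add_box p t) -> 1 < t /\ part p t.-1 = part p t.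
Proof.
move=> hp ht hn.
case: (leqP t 1) => h1.
  case/negP: hn; have {ht h1}->: t = 1 by lia.
  apply/is_partitionP; split=> [k hk|].
    rewrite !part_add_box //; have := part_homo hp hk (leqnSn k); lia.
  by move/is_partitionP: hp => [_]; case: p => [|y p] //; rewrite !inE !negb_or /=; lia.
split=> //; have h2 := part_homo hp (k := t.-1) (l := t) ltac:(lia) ltac:(lia).
apply/eqP; rewrite eqn_leq h2 andbT leqNgt; apply/negP => h3.
case/negP: hn; apply/is_partitionP; split=> [k hk|].
  rewrite !part_add_box //; have := part_homo hp hk (leqnSn k).
  case: (eqVneq t k) => //=; case: (eqVneq t k.+1) => [e|] //=; try lia.
  by move: h3; rewrite e /=; lia.
apply/negP => /(nthP 0) [i hi h0].
have := part_add_box p (t := t) (u := i.+1) ht isT.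
rewrite {1}/part /= h0 => /esym /eqP; rewrite addn_eq0 => /andP[/eqP h4].
rewrite eqb0 => /eqP h5.
move: hi; rewrite /add_box size_incr_nth; case: ifP => h6 hi.
  by have := part_pos hp (k := i.+1) isT; rewrite h4 hi.
have : 0 < part p t.-1 by lia.
by have := part_pos hp (k := i.+1) isT; rewrite h4 part_pos //; lia.
Qed.

(** The entries that are at least [j] form a prefix of a weakly decreasing sequence; [0 < j] keeps
    the default 0 past the end below [j]. *)
Lemma count_leq_nth p i j : sorted geq p -> 0 < j ->
  (i < count (leq j) p) = (j <= nth 0 p i).
Proof.
move=> + j0; elim: p i => [|y p IH] i /=; first by rewrite nth_nil; lia.
move=> hs; have hs' := path_sorted hs.
case: (leqP j y) => hy /=.
  by case: i => [|i] /=; [rewrite hy|rewrite add1n ltnS IH].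
have hall : all (fun z => z < j) p.
  have /allP h := order_path_min (rev_trans leq_trans) hs.
  by apply/allP => z /h /= hz; lia.
rewrite (_ : count _ p = 0) ?addn0; last first.
  by apply/eqP; rewrite -leqn0 leqNgt -has_count -all_predC; apply: sub_all hall => z /=; lia.
case: i => [|i] /=; first by lia.
symmetry; apply/negbTE; rewrite -ltnNge.
case: (ltnP i (size p)) => hi; last by rewrite nth_default.
by apply: (allP hall); exact: mem_nth.
Qed.

Lemma conj_partE p i j : is_partition p -> 0 < i -> 0 < j ->
  (i <= conj_part p j) = (j <= part p i).
Proof.
by case: i => // i /andP[hs _] _ j0; rewrite /conj_part /part /= -count_leq_nth.
Qed.

Lemma count_iota_leq y M : count (fun j => j <= y) (iota 1 M) = minn y M.
Proof.
by elim: M => [|M IH]; rewrite ?minn0 // -[M.+1]addn1 iotaD count_cat IH /=; lia.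
Qed.

Lemma conj_part_le p i j : is_partition p -> 0 < i -> i <= j ->
  conj_part p j <= conj_part p i.
Proof. by move=> _ _ hij; apply: sub_count => y /=; lia. Qed.

Lemma in_diagE p b : is_partition p ->
  in_diag p b = [&& 0 < b.1, 0 < b.2 & b.1 <= conj_part p b.2].
Proof.
case: b => [i j] hp; rewrite /in_diag /=.
case: (posnP i) => [->|i0] //; case: (posnP j) => [->|j0] //=; first by rewrite andbF.
rewrite conj_partE //; case: (leqP j _) => hj; rewrite ?andbF // andbT.
by rewrite -(part_pos hp) //; lia.
Qed.

(** * Boxes read column by column *)

Definition heights p := [seq conj_part p j | j <- iota 1 (part p 1)].

Lemma sumn_heights p : is_partition p -> sumn (heights p) = sumn p.
Proof.
move=> hp; rewrite /heights.
have hle : all (fun y => y <= part p 1) p.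
  apply/allP => y /(nthP 0) [i hi <-]; exact: (part_homo hp (k := 1) (l := i.+1)).
(* The number of columns is generalised to any bound on the parts, since deleting the first row
   changes [part p 1]. *)
rewrite /conj_part; elim: p (part p 1) hle {hp} => [|y p IH] M /=.
  by move=> _; elim: (iota 1 M).
case/andP=> hy /IH <-.
have -> : sumn [seq (j <= y) + count (leq j) p | j <- iota 1 M] =
  sumn [seq ((j <= y) : nat) | j <- iota 1 M] + sumn [seq count (leq j) p | j <- iota 1 M].
  by elim: (iota 1 M) => //= z s ->; rewrite addnACA.
by congr (_ + _); rewrite sumn_count count_iota_leq; lia.
Qed.

Lemma mem_boxes p b : is_partition p -> (b \in boxes p) = in_diag p b.
Proof.
move=> hp; case: b => i j; rewrite in_diagE //=.
apply/flattenP/idP => [[s /mapP [j' hj' ->] /mapP [i' hi' [-> ->]]]|/and3P[i0 j0 hi]].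
  by move: hj' hi'; rewrite mem_rev !mem_iota; lia.
exists [seq (i', j) | i' <- rev (iota 1 (conj_part p j))].
  apply/mapP; exists j => //; rewrite mem_iota j0 add1n ltnS.
  by rewrite conj_partE // in hi; apply: leq_trans hi (part_homo hp _ i0).
by apply/mapP; exists i => //; rewrite mem_rev mem_iota i0 add1n ltnS.
Qed.

(** Recursion on the column heights, starting at column [j], allows induction column by column. *)
Fixpoint boxes_from j hs : seq box :=
  if hs is h :: hs' then [seq (i, j) | i <- rev (iota 1 h)] ++ boxes_from j.+1 hs' else [::].

Lemma boxesE p : boxes p = boxes_from 1 (heights p).
Proof.
have H M j : flatten [seq [seq (i, j') | i <- rev (iota 1 (conj_part p j'))] | j' <- iota j M]
  = boxes_from j [seq conj_part p j' | j' <- iota j M].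
  by elim: M j => //= M IH j; rewrite IH.
exact: H.
Qed.

Lemma size_boxes_from j hs : size (boxes_from j hs) = sumn hs.
Proof. by elim: hs j => //= h hs IH j; rewrite size_cat size_map size_rev size_iota IH. Qed.

Lemma size_boxes p : is_partition p -> size (boxes p) = sumn p.
Proof. by move=> hp; rewrite boxesE size_boxes_from sumn_heights. Qed.

Lemma boxes_from_ge j hs b : b \in boxes_from j hs -> j <= b.2.
Proof.
elim: hs j => //= h hs IH j; rewrite mem_cat => /orP[/mapP [i _ ->] //|/IH]; lia.
Qed.

Lemma uniq_boxes_from j hs : uniq (boxes_from j hs).
Proof.
elim: hs j => //= h hs IH j; rewrite cat_uniq IH andbT map_inj_uniq; last by move=> u v [].
rewrite rev_uniq iota_uniq /=; apply/hasPn => b /boxes_from_ge hb.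
by apply/negP => /mapP [i _ e]; move: hb; rewrite e /=; lia.
Qed.

Lemma uniq_boxes p : uniq (boxes p).
Proof. by rewrite boxesE uniq_boxes_from. Qed.

Lemma boxes_from_pairwise j hs :
  pairwise (fun b c : box => b.2 <= c.2) (boxes_from j hs).
Proof.
elim: hs j => //= h hs IH j; rewrite pairwise_cat IH andbT; apply/andP; split.
  by apply/allrelP => b c /mapP [i _ ->] /boxes_from_ge /=; lia.
by rewrite pairwise_map; elim: (rev _) => //= i s ->; rewrite andbT; apply/allP => k _ /=.
Qed.

(** * Columns of tableaux *)

(* A column is an increasing word [c], read from bottom to top; its entry [t] is
   in row [cge t c], so top-aligned dominance of columns becomes [gale]. *)
Definition cge t (c : seq nat) := count (leq t) c.

Definition gale n c d := all (fun t => cge t d <= cge t c) (iota 0 n.+2).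

Definition cols n h := [seq c <- words h n | sorted ltn c].

(** The row of [t] is [cge t c], so the second component is [T(alpha) - c(alpha)] in column [j]. *)
Definition annot j c : seq (nat * int) := [seq (t, (t + cge t c)%:Z - j%:Z)%R | t <- c].

(** The column [c] to the left is prescribed, as the induction requires; the choice [c = iota 1 n]
    imposes no restriction. *)
Fixpoint tabs n j hs c : seq (seq (nat * int)) :=
  if hs is h :: hs' then
    [seq annot j d ++ w | d <- [seq d <- cols n h | gale n c d], w <- tabs n j.+1 hs' d]
  else [:: [::]].

Definition swap s t := if t == s then s.+1 else if t == s.+1 then s else t.

Ltac swap_lia := rewrite /swap;
  repeat match goal with
  | |- context [if ?b then _ else _] =>
    match b with context [if _ then _ else _] => fail 1 | _ => case: (boolP b) => ? end
  end; lia.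

Lemma swapK s : involutive (swap s).
Proof. by move=> t; swap_lia. Qed.

Lemma swap_id s t : t != s -> t != s.+1 -> swap s t = t.
Proof. by swap_lia. Qed.

Lemma swap_s s : swap s s = s.+1.
Proof. by rewrite /swap eqxx. Qed.

Lemma swap_s1 s : swap s s.+1 = s.
Proof. by rewrite /swap eqxx (_ : s.+1 == s = false) //; lia. Qed.

Lemma mem_cols n h c :
  (c \in cols n h) = [&& sorted ltn c, size c == h & all (fun t => 0 < t <= n) c].
Proof. by rewrite mem_filter mem_words. Qed.

Lemma sorted_ltn_uniq c : sorted ltn c -> uniq c.
Proof. by apply: sorted_uniq; [exact: ltn_trans|exact: ltnn]. Qed.

Lemma cgeS t c : sorted ltn c -> cge t c = cge t.+1 c + (t \in c).
Proof.
move=> hc; rewrite -(count_uniq_mem _ (sorted_ltn_uniq hc)) /cge.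
by elim: c {hc} => //= y c ->; lia.
Qed.

Lemma cge_big n t c : all (fun t => 0 < t <= n) c -> n < t -> cge t c = 0.
Proof.
move=> hc hn; apply/eqP; rewrite -leqn0 leqNgt -has_count -all_predC.
by apply: sub_all hc => y /=; lia.
Qed.

Lemma galeP n c d : all (fun t => 0 < t <= n) d ->
  reflect (forall t, cge t d <= cge t c) (gale n c d).
Proof.
move=> hd; apply: (iffP allP) => [h t|h t _ //].
case: (ltnP n t) => ht; first by rewrite (cge_big hd).
by apply: h; rewrite mem_iota; lia.
Qed.

(** * Exchanging [s] and [s+1] in a column *)

Section Swap.
Variable s : nat.

(** Columns containing exactly one of [s] and [s+1] are paired by the exchange; the lower one
    represents the pair. Balanced columns stay outside the pairing. *)
Definition lower (c : seq nat) := (s \in c) && (s.+1 \notin c).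

Definition balanced (c : seq nat) := (s \in c) == (s.+1 \in c).

Notation sw := (map (swap s)).

Lemma mem_sw t c : (t \in sw c) = (swap s t \in c).
Proof. by rewrite -{1}(swapK s t) mem_map //; exact: inv_inj (swapK s). Qed.

Lemma cge_sw t c : t != s.+1 -> cge t (sw c) = cge t c.
Proof. by move=> ht; rewrite /cge count_map; apply: eq_count => u /=; swap_lia. Qed.

Lemma sorted_sw c : ~~ balanced c -> sorted ltn c -> sorted ltn (sw c).
Proof.
move=> hb hc; apply: (homo_sorted_in (P := mem c) (e := ltn) _ _ hc); last by apply/allP.
move=> u v hu hv /= huv; move: hb; rewrite /balanced.
case: (eqVneq u s) => [e|e1]; [subst u|].
  by rewrite hu; case: (eqVneq v s.+1) hv => [-> -> //|]; swap_lia.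
case: (eqVneq v s.+1) => [e|]; [subst v|]; swap_lia.
Qed.

(** The new entry [s+1] occupies the row that [s] had, namely [cge s c]. *)
Lemma cge_sw_lower c : sorted ltn c -> lower c -> cge s.+1 (sw c) = cge s c.
Proof.
move=> hc /andP[h1 h2]; rewrite cgeS ?mem_sw; last first.
  by apply: sorted_sw => //; rewrite /balanced h1 (negbTE h2).
rewrite cge_sw; last by lia.
rewrite swap_s1 h1.
by rewrite (cgeS s) // (cgeS s.+1) // h1 (negbTE h2) addn0.
Qed.

Lemma sw_cols n h c : 0 < s -> s < n -> ~~ balanced c -> (sw c \in cols n h) = (c \in cols n h).
Proof.
move=> s0 sn; wlog suff H : c / ~~ balanced c -> c \in cols n h -> sw c \in cols n h.
  move=> hb; apply/idP/idP; last exact: H.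
  rewrite -{2}(mapK (swapK s) c); apply: H.
  rewrite /balanced !mem_sw.
  by rewrite swap_s swap_s1 eq_sym.
move=> hb; rewrite !mem_cols size_map => /and3P[h1 -> h2]; rewrite sorted_sw //=.
by rewrite all_map; apply: sub_all h2 => t /=; swap_lia.
Qed.

(** [P] is tested on [d] and [sw d] separately because dominance by a fixed column need not be
    invariant under the exchange. *)
Lemma big_cols_swap (R : nmodType) n h (P : pred (seq nat)) (F : seq nat -> R) :
  0 < s -> s < n ->
  (\sum_(d <- cols n h | P d) F d =
   \sum_(d <- cols n h | P d && balanced d) F d +
   \sum_(d <- cols n h | lower d) ((if P d then F d else 0) +
        (if P (sw d) then F (sw d) else 0)))%R.
Proof.
move=> s0 sn; rewrite (bigID balanced) /=; congr (_ + _)%R.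
rewrite (bigID lower) /= big_split /=; congr (_ + _)%R.
  rewrite -big_mkcondr; apply: eq_bigl => d; rewrite /balanced /lower.
  by case: (s \in d); case: (s.+1 \in d); rewrite ?andbT ?andbF.
rewrite -big_mkcondr -[RHS]big_filter -[LHS]big_filter.
rewrite -(big_map sw predT) /=; apply: perm_big; apply: uniq_perm.
- exact/filter_uniq/filter_uniq/uniq_words.
- rewrite map_inj_uniq; last exact/inj_map/inv_inj/swapK.
  exact/filter_uniq/filter_uniq/uniq_words.
move=> d; rewrite -[d in RHS](mapK (swapK s)) mem_map; last exact/inj_map/inv_inj/swapK.
rewrite !mem_filter (mapK (swapK s)).
have e1 := swap_s1 s; have e2 := swap_s s.
rewrite -!mem_filter.
case hb : (balanced d).
  by rewrite /lower /balanced !mem_sw e1 e2 in hb *; move: hb;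
    case: (s \in d); case: (s.+1 \in d); rewrite ?andbF.
rewrite -[sw d \in _]/(sw d \in cols n h) sw_cols ?hb //= -[d \in filter _ _]/(d \in cols n h).
move: hb; rewrite /lower /balanced !mem_sw e1 e2.
by case: (s \in d); case: (s.+1 \in d); rewrite ?andbF ?andbT //= andbC.
Qed.

End Swap.

(** * Partial symmetry of sums over tableaux *)

Section BenderKnuth.
Variables (R : comPzRingType) (a : int -> R) (n : nat).
Implicit Types (x : nat -> R) (c d : seq nat).
Local Open Scope ring_scope.

Definition wprod x (w : seq (nat * int)) : R := \prod_(p <- w) (x p.1 - a p.2).

Definition colfac j c x t : R := x t - a ((t + cge t c)%:Z - j%:Z).

Definition tabsum j hs c x : R := \sum_(w <- tabs n j hs c) wprod x w.

Lemma wprod_annot j c x : wprod x (annot j c) = \prod_(t <- c) colfac j c x t.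
Proof. by rewrite /wprod big_map. Qed.

Lemma tabsum_cons j h hs c x :
  tabsum j (h :: hs) c x =
  \sum_(d <- cols n h | gale n c d) wprod x (annot j d) * tabsum j.+1 hs d x.
Proof.
rewrite /tabsum /= big_allpairs_dep big_filter; apply: eq_bigr => d _.
by rewrite mulr_sumr; apply: eq_bigr => w _; rewrite /wprod big_cat.
Qed.

Lemma eq_tabsum j hs c x y : x =1 y -> tabsum j hs c x = tabsum j hs c y.
Proof.
by move=> e; apply: eq_bigr => w _; apply: eq_bigr => p _; rewrite e.
Qed.

Variable s : nat.
Hypotheses (s0 : (0 < s)%N) (sn : (s < n)%N).
Notation sw := (map (swap s)).

(** If [s] and [s+1] both occur, they lie in adjacent rows with [s+1] above, so
    [T(alpha) - c(alpha)] agrees for them and the exchange merely permutes their two factors. *)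
Lemma wprod_balanced j c x : sorted ltn c -> balanced s c ->
  wprod (x \o swap s) (annot j c) = wprod x (annot j c).
Proof.
move=> hc hb; rewrite !wprod_annot.
have hm t : (swap s t \in c) = (t \in c).
  case: (eqVneq t s) => [->|h1]; first by rewrite swap_s; apply/esym/eqP.
  case: (eqVneq t s.+1) => [->|h2]; first by rewrite swap_s1; apply/eqP.
  by rewrite swap_id.
transitivity (\prod_(t <- c) colfac j c x (swap s t)).
  apply: eq_big_seq => t ht; rewrite /colfac /=.
  suff -> : (swap s t + cge (swap s t) c = t + cge t c)%N by [].
  case: (eqVneq t s) ht => [->|h1] ht.
    by rewrite swap_s (cgeS s hc) ht; lia.
  case: (eqVneq t s.+1) ht => [->|h2] ht; last by rewrite swap_id.
  by move: hb; rewrite /balanced ht swap_s1 (cgeS s hc) => /eqP ->; lia.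
rewrite -(big_map (swap s) predT (colfac j c x)); apply: perm_big.
apply: uniq_perm; last 1 first.
- by move=> t; rewrite mem_sw hm.
- by rewrite map_inj_uniq ?sorted_ltn_uniq //; exact/inv_inj/swapK.
- exact: sorted_ltn_uniq.
Qed.

Definition colrest j c x : R := \prod_(t <- c | t != s) colfac j c x t.

Lemma wprod_lower j c x : sorted ltn c -> lower s c ->
  wprod x (annot j c) = (x s - a ((s + cge s c)%:Z - j%:Z)) * colrest j c x.
Proof.
by move=> hc /andP[h _]; rewrite wprod_annot (bigD1_seq s) ?sorted_ltn_uniq.
Qed.

(** Every box keeps its row, so one factor changes: its entry and its index of [a] both go up by
    one. *)
Lemma wprod_sw_lower j c x : sorted ltn c -> lower s c ->
  wprod x (annot j (sw c)) =
    (x s.+1 - a ((s.+1 + cge s c)%:Z - j%:Z)) * colrest j c x.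
Proof.
move=> hc hl; case/andP: (hl) => h1 h2; rewrite wprod_annot big_map.
rewrite (bigD1_seq s) ?sorted_ltn_uniq //= swap_s {1}/colfac cge_sw_lower //.
congr (_ * _); rewrite /colrest -big_filter -[in RHS]big_filter; apply: eq_big_seq => t.
rewrite mem_filter => /andP[h3 h4].
have h5 : t != s.+1 by apply: contraNneq h2 => <-.
by rewrite swap_id // /colfac cge_sw.
Qed.

Lemma colrest_swap j c x : lower s c -> colrest j c (x \o swap s) = colrest j c x.
Proof.
case/andP=> h1 h2; rewrite /colrest -big_filter -[in RHS]big_filter.
apply: eq_big_seq => t; rewrite mem_filter => /andP[h3 h4].
have h5 : t != s.+1 by apply: contraNneq h2 => <-.
by rewrite /colfac /= swap_id.
Qed.

(** The exchange alters only the count of [d] at threshold [s+1], which rises to [cge s d]. *)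
Lemma gale_sw_lower c d : sorted ltn d -> lower s d -> all (fun t => 0 < t <= n)%N d ->
  gale n c (sw d) = gale n c d && (cge s d <= cge s.+1 c)%N.
Proof.
move=> hd hl hn.
have hn' : all (fun t => 0 < t <= n)%N (sw d).
  by rewrite all_map; apply: sub_all hn => t /=; swap_lia.
apply/(galeP c hn')/andP => [h|[/(galeP c hn) h h'] t].
  split; last by rewrite -(cge_sw_lower hd hl).
  apply/(galeP c hn) => t; case: (eqVneq t s.+1) => [->|ht].
    apply: leq_trans (h s.+1); rewrite cge_sw_lower // (cgeS s hd); lia.
  by rewrite -(cge_sw _ ht).
case: (eqVneq t s.+1) => [->|ht]; first by rewrite cge_sw_lower.
by rewrite cge_sw.
Qed.

(** The extra inequality of [gale_sw_lower] is automatic: without [s] in [c] it is the inequality at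
    threshold [s], and with both entries in [c] it follows from threshold [s+2]. *)
Lemma gale_sw_lower_closed c d : sorted ltn c -> sorted ltn d ->
  (s \in c -> s.+1 \in c) ->
  lower s d -> all (fun t => 0 < t <= n)%N d -> gale n c (sw d) = gale n c d.
Proof.
move=> hc hd hs hl hn; rewrite gale_sw_lower //.
case: (boolP (gale n c d)) => //= /(galeP c hn) h.
case/andP: hl => h1 h2; have e1 := cgeS s hd; have e2 := cgeS s.+1 hd.
have e3 := cgeS s hc; have e4 := cgeS s.+1 hc.
move: (h s) (h s.+1) (h s.+2); rewrite h1 (negbTE h2) in e1 e2.
by case: (s \in c) hs e3 => [->//|] _ e3 in e4 *; lia.
Qed.

(** Passing to [sw c] weakens only the bound at threshold [s+1], by one. It is recovered from
    threshold [s+2] if [s+1] is absent from [d], and from threshold [s] if [d] contains both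
    entries. *)
Lemma gale_lower_sw c d : sorted ltn c -> sorted ltn d -> lower s c ->
  (s.+1 \in d -> s \in d) -> all (fun t => 0 < t <= n)%N d -> gale n (sw c) d = gale n c d.
Proof.
move=> hc hd hl hs hn; case/andP: (hl) => h1 h2.
have e1 := cgeS s hd; have e2 := cgeS s.+1 hd.
have e3 := cgeS s hc; have e4 := cgeS s.+1 hc; rewrite h1 (negbTE h2) in e3 e4.
apply/(galeP _ hn)/(galeP _ hn) => h t; last first.
  case: (eqVneq t s.+1) => [->|ht]; last by rewrite cge_sw.
  by rewrite cge_sw_lower //; apply: leq_trans (h _) _; lia.
case: (eqVneq t s.+1) => [->|ht]; last by rewrite -(cge_sw c ht).
move: (h s) (h s.+2); rewrite !cge_sw; [|lia..].
by case: (s.+1 \in d) hs e2 => [-> //|] _ e2 in e1 *; lia.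
Qed.

(* Second clause: when [c] contains [s] but not [s+1], only the sum over the
   two ways of filling that box of [c] is symmetric. *)
Lemma tabsum_swap hs j c x : sorted ltn c ->
  ((s \in c -> s.+1 \in c) -> tabsum j hs c (x \o swap s) = tabsum j hs c x) /\
  (lower s c ->
     let Phi y := (y s - a ((s + cge s c)%:Z - j%:Z + 1)) * tabsum j hs c y +
       (y s.+1 - a ((s.+1 + cge s c)%:Z - j%:Z + 1)) * tabsum j hs (sw c) y in
     Phi (x \o swap s) = Phi x).
Proof.
elim: hs j c => [|h hs IH] j c hc.
  rewrite /tabsum /= !big_seq1 /wprod !big_nil; split=> // _ /=.
  rewrite swap_s swap_s1 !mulr1.
  rewrite (_ : (s.+1 + cge s c)%:Z - j%:Z + 1 = (s + cge s c)%:Z - j%:Z + 2); last by lia.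
  by ring.
(* [d] is the column after [c]; for lower [d], [A d] and [B d] are the terms of [a] at the box
   holding [s], before and after the exchange. *)
pose G d y := wprod y (annot j d) * tabsum j.+1 hs d y.
pose A d := a ((s + cge s d)%:Z - j%:Z).
pose B d := a ((s.+1 + cge s d)%:Z - j%:Z).
have hbal d : d \in cols n h -> balanced s d -> G d (x \o swap s) = G d x.
  rewrite mem_cols => /and3P[hd _ _] hb; rewrite /G wprod_balanced //.
  by case: (IH j.+1 d hd) => -> //; move/eqP: hb => ->.
have hG d y : d \in cols n h -> lower s d ->
    G d y = colrest j d y * ((y s - A d) * tabsum j.+1 hs d y).
  by rewrite mem_cols => /and3P[hd _ _] hl; rewrite /G wprod_lower // mulrAC mulrC.
have hGs d y : d \in cols n h -> lower s d ->
    G (sw d) y = colrest j d y * ((y s.+1 - B d) * tabsum j.+1 hs (sw d) y).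
  by rewrite mem_cols => /and3P[hd _ _] hl; rewrite /G wprod_sw_lower // mulrAC mulrC.
have hsw d : d \in cols n h -> lower s d ->
    tabsum j.+1 hs (sw d) (x \o swap s) = tabsum j.+1 hs (sw d) x.
  rewrite mem_cols => /and3P[hd _ _] /andP[h1 h2].
  case: (IH j.+1 (sw d)) => [|-> //]; first by apply: sorted_sw; rewrite // /balanced h1 (negbTE h2).
  by rewrite !mem_sw swap_s swap_s1 h1.
(* This is the second clause of the induction hypothesis for [d]; passing from [j] to [j+1] absorbs
   the shift by 1 in the indices of [a]. *)
have hPsi d : d \in cols n h -> lower s d ->
    (x s.+1 - A d) * tabsum j.+1 hs d (x \o swap s) + (x s - B d) * tabsum j.+1 hs (sw d) x =
    (x s - A d) * tabsum j.+1 hs d x + (x s.+1 - B d) * tabsum j.+1 hs (sw d) x.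
  move=> hd hl; rewrite -{1}(hsw d) //; move: hd; rewrite mem_cols => /and3P[hd _ _].
  case: (IH j.+1 d hd) => _ /(_ hl) /=; rewrite swap_s swap_s1.
  have e u : u%:Z - j.+1%:Z + 1 = u%:Z - j%:Z by lia.
  by rewrite !e.
have hpair d : d \in cols n h -> lower s d ->
    G d (x \o swap s) + G (sw d) (x \o swap s) = G d x + G (sw d) x.
  move=> hd hl; rewrite !(hG d) // !hGs // -!mulrDr colrest_swap // hsw //=.
  by rewrite swap_s swap_s1 hPsi.
(* In the first clause [c] admits both or neither of [d] and [sw d], so only complete pairs
   occur. *)
split=> [hs1|hl /=].
  rewrite !tabsum_cons [LHS](big_cols_swap _ _ _ s0 sn) [RHS](big_cols_swap _ _ _ s0 sn).
  congr (_ + _); rewrite big_seq_cond [RHS]big_seq_cond.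
    by apply: eq_bigr => d /and3P[hd _ hb]; exact: hbal.
  apply: eq_bigr => d /andP[hd hl]; move: (hd); rewrite mem_cols => /and3P[sd _ nd].
  by rewrite gale_sw_lower_closed //; case: ifP => // _; exact: hpair.
pose X y := y s - a ((s + cge s c)%:Z - j%:Z + 1).
pose Y y := y s.+1 - a ((s.+1 + cge s c)%:Z - j%:Z + 1).
pose Q y := \sum_(d <- cols n h | gale n c d && balanced s d) G d y.
pose g c d (z : R) := if gale n c d then z else 0.
have hc' : sorted ltn (sw c).
  by apply: sorted_sw => //; case/andP: hl => h1 h2; rewrite /balanced h1 (negbTE h2).
(* After [sw c] only complete pairs occur, whereas [c] may admit [d] and reject [sw d]. *)
have hPhi y (p q : R) : p * tabsum j (h :: hs) c y + q * tabsum j (h :: hs) (sw c) y =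
    (p + q) * Q y + \sum_(d <- cols n h | lower s d)
      (p * (g c d (G d y) + g c (sw d) (G (sw d) y)) + q * (g c d (G d y + G (sw d) y))).
  rewrite big_split /= -!mulr_sumr mulrDl.
  rewrite !tabsum_cons (big_cols_swap _ (gale n c) _ s0 sn) (big_cols_swap _ (gale n (sw c)) _ s0 sn) !mulrDr.
  rewrite addrACA; congr (_ + (_ + _)).
    congr (_ * _ + _ * _); rewrite big_seq_cond [RHS]big_seq_cond; apply: eq_bigl => d.
    case: (boolP (d \in _)) => //=; rewrite mem_cols => /and3P[sd _ nd].
    case: (boolP (balanced s d)); rewrite ?andbF // !andbT => /eqP hb.
    by rewrite gale_lower_sw // hb.
  congr (_ * _); rewrite big_seq_cond [RHS]big_seq_cond; apply: eq_bigr => d /andP[hd ld].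
  move: (hd); rewrite mem_cols => /and3P[sd _ nd]; case/andP: (ld) => ld1 ld2.
  rewrite gale_sw_lower_closed // ?gale_lower_sw // ?(negbTE ld2) //; last first.
    by rewrite !mem_sw swap_s swap_s1; case/andP: hl.
  by rewrite /g; case: ifP => // _; rewrite addr0.
rewrite -[LHS]/(X (x \o swap s) * _ + Y (x \o swap s) * _) -[RHS]/(X x * _ + Y x * _) !hPhi.
congr (_ * _ + _).
- rewrite /X /Y /= swap_s swap_s1; rewrite addrACA [RHS]addrACA; congr (_ + _); exact: addrC.
- rewrite /Q big_seq_cond [RHS]big_seq_cond.
  by apply: eq_bigr => d /and3P[hd _ hb]; exact: hbal.
rewrite big_seq_cond [RHS]big_seq_cond; apply: eq_bigr => d /andP[hd ld].
move: (hd); rewrite mem_cols => /and3P[sd _ nd].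
rewrite /g gale_sw_lower //; case: ifP => [hcd|] /=; last by rewrite !addr0 !mulr0 addr0.
have := galeP c nd hcd s; have := cgeS s hc; case/andP: (hl) => -> _ ec lec.
case: ifP => hlt.
  rewrite -!mulrDl hpair //; congr (_ * _); rewrite /X /Y /= swap_s swap_s1.
  by rewrite addrACA [RHS]addrACA; congr (_ + _); exact: addrC.
(* Otherwise [s] has the same row in [d] as in [c], so [B d] is the term of [a] in [X]; given
   [hPsi], symmetry becomes a polynomial identity. *)
have er : cge s d = cge s c by lia.
rewrite hpair // !addr0 !(hG d) // hGs // -mulrDr colrest_swap //= swap_s.
have := hPsi d hd ld; move: (tabsum _ _ _ (x \o _)) (tabsum _ _ _ x) (tabsum _ _ (sw d) _).
rewrite /X /Y /= swap_s swap_s1 /A /B er.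
have -> : (s.+1 + cge s c)%:Z - j%:Z = (s + cge s c)%:Z - j%:Z + 1 by lia.
move: (a _) (a _) (a _) (colrest _ _ _) (x s) (x s.+1) => A0 A1 A2 K z1 z2 u1 u2 u3 e.
have {e}e : (z2 - A2) * u1 = (z1 - A2) * u2 + (z2 - A1) * u3 - (z1 - A1) * u3.
  by rewrite -e addrK.
by rewrite e; ring.
Qed.
End BenderKnuth.

(** * Alternants *)

Definition relabel n (w : 'S_n) (k : nat) : nat :=
  if k is k'.+1 then if insub k' is Some i then (w i).+1 else k else 0.

Arguments relabel : simpl never.

Section Alternants.
Variables (R : comPzRingType) (n : nat).
Implicit Types (x y : nat -> R) (f g : (nat -> R) -> R).
Local Open Scope ring_scope.

Lemma relabelE (w : 'S_n) (i : 'I_n) : relabel w i.+1 = (w i).+1.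
Proof. by rewrite /relabel valK. Qed.

Lemma relabel_out (w : 'S_n) k : (n <= k)%N -> relabel w k.+1 = k.+1.
Proof. by move=> h; rewrite /relabel insubF //; apply/negbTE; rewrite -leqNgt. Qed.

Lemma relabel1 : relabel (1%g : 'S_n) =1 id.
Proof.
case=> // k; case: (ltnP k n) => h; last exact: relabel_out.
by rewrite (relabelE 1 (Ordinal h)) perm1.
Qed.

Lemma relabelM (u v : 'S_n) : relabel (u * v)%g =1 relabel v \o relabel u.
Proof.
case=> // k /=; case: (ltnP k n) => h; last by rewrite !relabel_out.
by rewrite -[k]/(val (Ordinal h)) !relabelE permM.
Qed.

Lemma relabel_tperm (i j : 'I_n) : j = i.+1 :> nat -> relabel (tperm i j) =1 swap i.+1.
Proof.
move=> e [|k]; first by rewrite /swap.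
case: (ltnP k n) => h; last first.
  rewrite relabel_out // swap_id //; apply/eqP => -[ek]; move: h; rewrite ek leqNgt ?ltn_ord //.
  by rewrite -e ltn_ord.
rewrite -[k]/(val (Ordinal h)) relabelE; case: tpermP => [->|->|h1 h2].
- by rewrite /= e swap_s.
- by rewrite /= e swap_s1.
rewrite swap_id //; apply/eqP => -[ek]; first by apply: h1; apply: val_inj.
by apply: h2; apply: val_inj; rewrite /= ek e.
Qed.

Definition alt f x : R := \sum_(w : 'S_n) (-1) ^+ w * f (x \o relabel w).

Lemma eq_alt f g x : f =1 g -> alt f x = alt g x.
Proof. by move=> e; apply: eq_bigr => w _; rewrite e. Qed.

Lemma altD f g x : alt (fun y => f y + g y) x = alt f x + alt g x.
Proof. by rewrite -big_split; apply: eq_bigr => w _; rewrite mulrDr. Qed.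

Lemma altZ k f x : alt (fun y => k * f y) x = k * alt f x.
Proof. by rewrite mulr_sumr; apply: eq_bigr => w _; rewrite mulrCA. Qed.

Lemma alt_sum (I : Type) (r : seq I) (P : pred I) (F : I -> (nat -> R) -> R) x :
  alt (fun y => \sum_(i <- r | P i) F i y) x = \sum_(i <- r | P i) alt (F i) x.
Proof.
by rewrite exchange_big; apply: eq_bigr => w _; rewrite mulr_sumr.
Qed.

(** Composition with the adjacent transposition pairs even with odd permutations and preserves the
    values of [f]. *)
Lemma alt_swap0 s f x : (0 < s < n)%N -> (forall y z, y =1 z -> f y = f z) ->
  (forall y, f (y \o swap s) = f y) -> alt f x = 0.
Proof.
case: s => // s /= hs ef fs.
have hs' : (s < n)%N by lia.
pose i := Ordinal hs'; pose j := Ordinal hs; pose t := tperm i j.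
have ft w : f (x \o relabel (t * w)%g) = f (x \o relabel w).
  rewrite -[RHS]fs; apply: ef => k /=; rewrite relabelM /=.
  by rewrite (@relabel_tperm i j).
rewrite /alt (bigID (@odd_perm _)) /= [X in _ + X](reindex_inj (mulgI t)) /=.
have ij : i != j by rewrite -val_eqE /=; lia.
rewrite [X in _ + X](eq_bigl (fun w : 'S_n => odd_perm w)); last first.
  by move=> w; rewrite odd_permM odd_tperm ij; case: (odd_perm w).
rewrite -big_split big1 //= => w hw; rewrite ft odd_permM odd_tperm ij hw /=.
by rewrite expr0 expr1 mulN1r mul1r addNr.
Qed.

Lemma relabel_sym f : (forall y z, y =1 z -> f y = f z) ->
  (forall s y, (0 < s < n)%N -> f (y \o swap s) = f y) ->
  forall (w : 'S_n) y, f (y \o relabel w) = f y.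
Proof.
move=> ef fs.
pose P (w : 'S_n) := forall y, f (y \o relabel w) = f y.
have P1 : P 1%g by move=> y; apply: ef => k /=; rewrite relabel1.
have PM u v : P u -> P v -> P (u * v)%g.
  move=> hu hv y; rewrite -[RHS]hv -[RHS]hu; apply: ef => k /=.
  by rewrite relabelM.
have Padj (i j : 'I_n) : j = i.+1 :> nat -> P (tperm i j).
  move=> e y; rewrite -[RHS](fs i.+1); last by rewrite /= -e ltn_ord.
  by apply: ef => k /=; rewrite relabel_tperm.
(* Induction on the distance: an adjacent transposition conjugates the given one to a transposition
   of closer indices. *)
have Pt k (i j : 'I_n) : j = (i + k)%N :> nat -> P (tperm i j).
  elim: k j => [|k IH] j e.
    by have -> : j = i; [apply: val_inj; rewrite /= e addn0|rewrite tperm1].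
  have hk : (i + k < n)%N by have := ltn_ord j; lia.
  case: k IH e hk => [|k] IH e hk; first by apply: Padj; rewrite e addn1.
  pose l := Ordinal hk; have hl : P (tperm l j) by apply: Padj; rewrite e /= addnS.
  have -> : tperm i j = (tperm l j * (tperm i l * tperm l j))%g.
    rewrite -{1}[tperm l j]tpermV -conjgE tpermJ.
    by rewrite tpermL tpermD // -val_eqE /= ?e; lia.
  exact (PM _ _ hl (PM _ _ (IH l erefl) hl)).
move=> w; rewrite -/(P w); case: (prod_tpermP w) => ts -> _.
apply: (big_ind P) => // -[i j] _ /=.
case: (leqP i j) => h; first by apply: (Pt (j - i)%N); rewrite subnKC.
by rewrite tpermC; apply: (Pt (i - j)%N); rewrite subnKC // ltnW.
Qed.

Variable a : int -> R.

Definition facpow (z : R) m := \prod_(k < m) (z - a (n%:Z - k%:Z)).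

(** This is the polynomial [e_rho] of the introduction, for [rho = p]. *)
Definition facmon (p : seq nat) x := \prod_(t <- iota 1 n) facpow (x t) (part p t + n - t).

Lemma eq_facmon p x y : x =1 y -> facmon p x = facmon p y.
Proof. by move=> e; apply: eq_bigr => t _; rewrite e. Qed.

(** The new factor of [x_t] has index [n - (p_t + n - t) = t - p_t]; [t <= n] keeps the truncated
    subtraction exact. *)
Lemma facmon_add_box p t x : (0 < t <= n)%N ->
  facmon (add_box p t) x = (x t - a (t%:Z - (part p t)%:Z)) * facmon p x.
Proof.
move=> ht; have hi : t \in iota 1 n by rewrite mem_iota; lia.
rewrite /facmon !(bigD1_seq t) ?iota_uniq //= mulrA; congr (_ * _).
  rewrite part_add_box ?eqxx; [|lia..].
  have -> : (part p t + true + n - t = (part p t + n - t).+1)%N by lia.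
  rewrite /facpow big_ord_recr /= mulrC; congr ((_ - a _) * _); lia.
rewrite -big_filter -[in RHS]big_filter; apply: eq_big_seq => u.
rewrite mem_filter mem_iota => /andP[hu hu']; rewrite part_add_box; [|lia..].
by rewrite eq_sym (negbTE hu) addn0.
Qed.

(** When [p_(t-1) = p_t], the box added to row [t] makes the numbers of factors for [x_(t-1)] and
    [x_t] equal. *)
Lemma facmon_swap p t x : (1 < t <= n)%N -> part p t.-1 = part p t ->
  facmon (add_box p t) (x \o swap t.-1) = facmon (add_box p t) x.
Proof.
case: t => [|[|t]] //= ht e; rewrite /facmon.
pose E u := (part (add_box p t.+2) u + n - u)%N.
transitivity (\prod_(u <- iota 1 n) facpow (x (swap t.+1 u)) (E (swap t.+1 u))).
  apply: eq_big_seq => u _; congr facpow; rewrite /E -/(E u).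
  case: (eqVneq u t.+1) => [->|h1].
    by rewrite swap_s /E !part_add_box // e eqxx; lia.
  case: (eqVneq u t.+2) => [->|h2]; last by rewrite swap_id.
  by rewrite swap_s1 /E !part_add_box // e eqxx; lia.
rewrite -(big_map (swap t.+1) predT (fun u => facpow (x u) (E u))).
apply: perm_big; apply: uniq_perm.
- by rewrite map_inj_uniq ?iota_uniq //; exact/inv_inj/swapK.
- exact: iota_uniq.
by move=> u; rewrite mem_sw !mem_iota; swap_lia.
Qed.

(** Generating function of the ways to bar letters of [w], starting from the diagram [p] and staying
    among partitions. *)
Fixpoint walk (F : seq nat -> R) (p : seq nat) (w : seq (nat * int)) : R :=
  if w is (t, i) :: w' then
    (if is_partition (add_box p t) then walk F (add_box p t) w' else 0) +
    (a (t%:Z - (part p t)%:Z) - a i) * walk F p w'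
  else F p.

(** Induction along the unread part [v] of the column [D]; the later columns are settled by
    hypothesis. The cancellation of walks leaving the partitions takes place here. *)
Lemma alt_column hs j D x v p : sorted ltn D -> all (fun t => 0 < t <= n)%N D ->
  (forall p, is_partition p ->
     alt (fun y => tabsum a n j hs D y * facmon p y) x =
     \sum_(w <- tabs n j hs D) walk (fun q => alt (facmon q) x) p w) ->
  sorted ltn (map fst v) -> {subset map fst v <= D} -> is_partition p ->
  alt (fun y => wprod a y v * (tabsum a n j hs D y * facmon p y)) x =
  \sum_(w <- tabs n j hs D) walk (fun q => alt (facmon q) x) p (v ++ w).
Proof.
move=> sD nD IH; elim: v p => [|[t i] v IHv] p sv dv hp.
  by rewrite -IH //; apply: eq_alt => y; rewrite /wprod big_nil mul1r.
have tD : t \in D by apply: dv; rewrite inE eqxx.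
have tn : (0 < t <= n)%N := allP nD _ tD.
have t0 : (0 < t)%N by lia.
have sv' : sorted ltn (map fst v) := path_sorted sv.
have dv' : {subset map fst v <= D} by move=> u hu; apply: dv; rewrite inE hu orbT.
rewrite /= big_split /= -mulr_sumr -IHv // -altZ.
have -> : \sum_(w <- tabs n j hs D) (if is_partition (add_box p t)
      then walk (fun q => alt (facmon q) x) (add_box p t) (v ++ w) else 0) =
    alt (fun y => wprod a y v * (tabsum a n j hs D y * facmon (add_box p t) y)) x.
  case: (boolP (is_partition (add_box p t))) => hp'; first by rewrite IHv.
  have [t1 e] := not_partition_add_box hp t0 hp'.
  (* At a bad step everything is symmetric in [x_(t-1)] and [x_t]: the entries of [v] exceed [t],
     and [t] in [D] gives the condition in the first clause of [tabsum_swap]. *)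
  rewrite big1 //; symmetry; apply: (@alt_swap0 t.-1); first by lia.
    move=> y z eyz; rewrite (eq_tabsum a n j hs D eyz) (eq_facmon _ eyz); congr (_ * _).
    by apply: eq_bigr => q _; rewrite eyz.
  move=> y; rewrite facmon_swap //; last by lia.
  have [-> _] := @tabsum_swap _ a n t.-1 ltac:(lia) ltac:(lia) hs j D y sD; last first.
    by rewrite prednK //; lia.
  congr (_ * _); apply: eq_big_seq => q hq /=; rewrite swap_id //.
    have := allP (order_path_min ltn_trans sv) q.1 (map_f _ hq); rewrite /=; lia.
  have := allP (order_path_min ltn_trans sv) q.1 (map_f _ hq); rewrite /=; lia.
rewrite -altD; apply: eq_alt => y; rewrite facmon_add_box // /wprod big_cons /=.
by ring.
Qed.

Lemma alt_tabsum hs j c x p : is_partition p ->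
  alt (fun y => tabsum a n j hs c y * facmon p y) x =
  \sum_(w <- tabs n j hs c) walk (fun q => alt (facmon q) x) p w.
Proof.
elim: hs j c p => [|h hs IH] j c p hp.
  by rewrite /= big_seq1 /=; apply: eq_alt => y; rewrite /tabsum /= big_seq1 /wprod big_nil mul1r.
rewrite /= big_allpairs_dep big_filter.
transitivity (\sum_(d <- cols n h | gale n c d)
   alt (fun y => wprod a y (annot j d) * (tabsum a n j.+1 hs d y * facmon p y)) x).
  rewrite -alt_sum; apply: eq_alt => y; rewrite tabsum_cons mulr_suml.
  by apply: eq_bigr => d _; rewrite mulrA.
rewrite big_seq_cond [RHS]big_seq_cond; apply: eq_bigr => d /andP[hd _].
move: hd; rewrite mem_cols => /and3P[sd _ nd].
have e : map fst (annot j d) = d by rewrite -map_comp map_id.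
by apply: alt_column; rewrite ?e // => q hq; apply: IH.
Qed.

(** The column [iota 1 n] contains every [s+1 <= n], so the first clause of [tabsum_swap] applies to
    each adjacent exchange. *)
Lemma tabsum_sym hs x (w : 'S_n) :
  tabsum a n 1 hs (iota 1 n) (x \o relabel w) = tabsum a n 1 hs (iota 1 n) x.
Proof.
apply: (relabel_sym (f := tabsum a n 1 hs (iota 1 n))) => [y z|s y hs'].
  exact: eq_tabsum.
have [-> // _] := @tabsum_swap _ a n s ltac:(lia) ltac:(lia) hs 1 (iota 1 n) y (iota_ltn_sorted _ _).
by rewrite !mem_iota; lia.
Qed.

Lemma tabsum_mul_alt hs x p : is_partition p ->
  tabsum a n 1 hs (iota 1 n) x * alt (facmon p) x =
  \sum_(w <- tabs n 1 hs (iota 1 n)) walk (fun q => alt (facmon q) x) p w.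
Proof.
move=> hp; rewrite -alt_tabsum // mulr_sumr; apply: eq_bigr => w _.
by rewrite tabsum_sym mulrCA.
Qed.

End Alternants.

(** * The alternant of the empty diagram *)

Section Vandermonde.
Variables (R : comNzRingType) (n : nat) (a : int -> R) (x : nat -> R).
Local Open Scope ring_scope.

(** Monic polynomials of degrees [0..n-1] evaluated at the [x_j] form a unitriangular matrix times
    the Vandermonde matrix. The sign comes from reversing the rows, as [x_t] carries [n - t]
    factors. *)
Lemma alt_facmon_nil : exists b : bool, alt n (facmon n a [::]) x =
  (-1) ^+ b * \prod_(i < n) \prod_(j < n | (i < j)%N) (x j.+1 - x i.+1).
Proof.
pose B := \matrix_(i < n, j < n) facpow n a (x j.+1) i.
pose P (i : nat) : {poly R} := \prod_(k < i) ('X - (a (n%:Z - k%:Z))%:P).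
have sP i : size (P i) = i.+1 by rewrite size_prod_XsubC /index_enum -enumT size_enum_ord.
have mP i : P i \is monic by exact: monic_prod_XsubC.
pose C := \matrix_(i < n, k < n) (P i)`_k.
pose V := Vandermonde n (\row_(j < n) x j.+1).
have BE : B = C *m V.
  apply/matrixP => i j; rewrite !mxE.
  have -> : facpow n a (x j.+1) i = (P i).[x j.+1].
    by rewrite horner_prod; apply: eq_bigr => k _; rewrite !hornerE.
  rewrite (horner_coef_wide (n := n)) ?sP //.
  by apply: eq_bigr => k _; rewrite !mxE.
have detC : \det C = 1.
  rewrite det_trig; last by apply/is_trig_mxP => i j h; rewrite mxE nth_default // sP.
  by apply: big1 => i _; rewrite mxE; have /monicP := mP i; rewrite lead_coefE sP.
have detB : \det B = \prod_(i < n) \prod_(j < n | (i < j)%N) (x j.+1 - x i.+1).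
  rewrite BE det_mulmx detC mul1r det_Vandermonde.
  by apply: eq_bigr => i _; apply: eq_bigr => j _; rewrite !mxE.
exists (odd_perm (perm (@rev_ord_inj n))).
rewrite -detB.
rewrite -det_perm -det_mulmx -row_permE.
apply: eq_bigr => w _; congr (_ * _).
rewrite /facmon (_ : iota 1 n = index_iota 1 n.+1) ?big_add1 /= ?big_mkord; last by rewrite /index_iota subn1.
apply: eq_bigr => i _; rewrite !mxE permE /= relabelE; congr facpow.
by rewrite /part nth_nil.
Qed.

End Vandermonde.

(** * Column description of reverse tableaux *)

Lemma big_words_add (R : nmodType) h N n (F : seq nat -> R) :
  (\sum_(t <- words (h + N) n) F t =
   \sum_(u <- words h n) \sum_(v <- words N n) F (u ++ v))%R.
Proof.
elim: h F => [|h IH] F /=; first by rewrite big_seq1.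
rewrite !big_allpairs_dep; apply: eq_bigr => k _.
by rewrite (IH (fun t => F (k :: t))).
Qed.

(** Links the nested enumeration [tabs] to the flat words of [dschur] and [LRformula], by cutting a
    word into columns. *)
Fixpoint tabword n hs c t :=
  if hs is h :: hs' then
    [&& sorted ltn (take h t), gale n c (take h t) & tabword n hs' (take h t) (drop h t)]
  else true.

Fixpoint annot_word j hs t :=
  if hs is h :: hs' then annot j (take h t) ++ annot_word j.+1 hs' (drop h t) else [::].

Lemma big_tabs (R : nmodType) n j hs c (H : seq (nat * int) -> R) :
  (\sum_(w <- tabs n j hs c) H w =
   \sum_(t <- words (sumn hs) n | tabword n hs c t) H (annot_word j hs t))%R.
Proof.
elim: hs j c H => [|h hs IH] j c H /=; first by rewrite !big_seq1.
rewrite big_allpairs_dep big_filter big_mkcond [RHS]big_mkcond big_words_add.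
rewrite big_filter big_mkcond /= big_seq [RHS]big_seq; apply: eq_bigr => u.
rewrite mem_words => /andP[/eqP su _].
transitivity (\sum_(v <- words (sumn hs) n) (if sorted ltn u && gale n c u && tabword n hs u v
   then H (annot j u ++ annot_word j.+1 hs v) else 0))%R; last first.
  by apply: eq_bigr => v _; rewrite take_size_cat // drop_size_cat // andbA.
case: (sorted ltn u) => /=; last by rewrite big1.
case: (gale n c u) => /=; last by rewrite big1.
by rewrite (IH _ _ (fun w => H (annot j u ++ w))) big_mkcond.
Qed.

Definition tcol (T : box -> nat) h j := [seq T (i, j) | i <- rev (iota 1 h)].

Lemma size_tcol T h j : size (tcol T h j) = h.
Proof. by rewrite size_map size_rev size_iota. Qed.

Lemma sorted_tcol T h j : reflect (forall i, 0 < i < h -> T (i.+1, j) < T (i, j))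
  (sorted ltn (tcol T h j)).
Proof.
rewrite /tcol map_rev rev_sorted.
apply: (iffP (sortedP 0)) => H i.
  case: i => // i hi; have := H i; rewrite size_map size_iota => /(_ hi).
  by rewrite !(nth_map 0) ?size_iota ?nth_iota //; lia.
rewrite size_map size_iota => hi.
by rewrite !(nth_map 0) ?size_iota ?nth_iota //; [apply: H|..]; lia.
Qed.

Lemma cge_tcol T h j i t : sorted ltn (tcol T h j) -> 0 < i -> 0 < t ->
  (i <= cge t (tcol T h j)) = (i <= h) && (t <= T (i, j)).
Proof.
case: i => // i hs _ t0; rewrite /cge -count_rev /tcol map_rev revK count_leq_nth //; last first.
  move: hs; rewrite /tcol map_rev rev_sorted; apply: sub_sorted => u v /=; lia.
case: (ltnP i h) => hi; last by rewrite nth_default ?size_map ?size_iota //; lia.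
by rewrite (nth_map 0) ?size_iota // nth_iota.
Qed.

Lemma cge0 c : cge 0 c = size c.
Proof. by rewrite /cge; elim: c => //= y c ->. Qed.

(** One direction takes the threshold [T (i, j')]; the other looks at the lowest row of column [j']
    whose entry reaches the threshold. *)
Lemma gale_tcol n T h h' j j' : sorted ltn (tcol T h j) -> sorted ltn (tcol T h' j') ->
  h' <= h -> all (fun t => 0 < t <= n) (tcol T h' j') ->
  reflect (forall i, 0 < i <= h' -> T (i, j') <= T (i, j)) (gale n (tcol T h j) (tcol T h' j')).
Proof.
move=> s1 s2 hh hn; apply: (iffP (galeP _ hn)) => H.
  move=> i hi; have Tpos : 0 < T (i, j').
    have := allP hn (T (i, j')); rewrite map_f ?mem_rev ?mem_iota; last by lia.
    by case/(_ isT)/andP.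
  have := H (T (i, j')); have := cge_tcol (i := i) s2 _ Tpos; have := cge_tcol (i := i) s1 _ Tpos.
  by rewrite leqnn => /(_ ltac:(lia)) e1 /(_ ltac:(lia)) e2; lia.
case=> [|t]; first by rewrite !cge0 !size_tcol.
case E : (cge t.+1 (tcol T h' j')) => [|k] //.
have := cge_tcol (i := k.+1) (t := t.+1) s2 isT isT; rewrite E leqnn => /esym /andP[h1 h2].
by rewrite cge_tcol // (leq_trans h1 hh) (leq_trans h2 (H _ _)).
Qed.

Lemma gale_iota n c : sorted ltn c -> all (fun t => 0 < t <= n) c -> gale n (iota 1 n) c.
Proof.
move=> sc nc; apply/(galeP _ nc) => t; rewrite /cge -!size_filter.
apply: uniq_leq_size; first exact/filter_uniq/sorted_ltn_uniq.
move=> u; rewrite !mem_filter => /andP[-> hu] /=; rewrite mem_iota.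
by have := allP nc _ hu; lia.
Qed.

Lemma map_boxes_from T j h hs :
  map T (boxes_from j (h :: hs)) = tcol T h j ++ map T (boxes_from j.+1 hs).
Proof. by rewrite /= map_cat -map_comp. Qed.

Lemma tabword_boxes n (H : nat -> nat) (T : box -> nat) M j c :
  reflect (forall k, j <= k < j + M -> sorted ltn (tcol T (H k) k) /\
             gale n (if k == j then c else tcol T (H k.-1) k.-1) (tcol T (H k) k))
    (tabword n (map H (iota j M)) c (map T (boxes_from j (map H (iota j M))))).
Proof.
elim: M j c => [|M IH] j c; first by apply: ReflectT => k; lia.
rewrite [iota _ _]/= [map H _]/= map_boxes_from /=.
rewrite take_size_cat ?size_tcol // drop_size_cat ?size_tcol //.
apply: (iffP and3P) => [[h1 h2 /IH h3] k hk|h].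
  case: eqVneq => [->|hj] //.
  have [] := h3 k ltac:(lia); case: eqVneq => [e|_] //.
  by rewrite e.
have [h1 h2] := h j ltac:(lia); rewrite eqxx in h2; split=> //.
apply/IH => k hk; have [h3 h4] := h k ltac:(lia); split=> //.
rewrite (_ : k == j = false) in h4; last by lia.
by case: eqVneq => // e; rewrite e in h4 *.
Qed.

Lemma sorted_index c : sorted ltn c -> forall k, k < size c ->
  cge (nth 0 c k) c = size c - k.
Proof.
elim: c => [|y c IH] //= hs [|k] hk /=.
  rewrite subn0 /cge /= leqnn add1n; congr _.+1; apply/eqP; rewrite -all_count.
  by have := order_path_min ltn_trans hs; apply: sub_all => z /=; lia.
rewrite /cge /= -/(cge _ c) IH ?(path_sorted hs) //.
have := allP (order_path_min ltn_trans hs) (nth 0 c k) (mem_nth _ hk); rewrite /=; lia.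
Qed.

Lemma annot_tcol T h j : sorted ltn (tcol T h j) ->
  annot j (tcol T h j) =
    [seq (T b, (T b)%:Z - content b)%R | b <- [seq (i, j) | i <- rev (iota 1 h)]].
Proof.
move=> hs; rewrite /annot; apply: (@eq_from_nth _ (0, 0%R)).
  by rewrite !size_map.
move=> k; rewrite size_map size_tcol => hk.
rewrite (nth_map 0) ?size_tcol // sorted_index ?size_tcol //.
rewrite (nth_map (0, 0)) ?size_map ?size_rev ?size_iota //.
rewrite !(nth_map 0) ?size_map ?size_rev ?size_iota // nth_rev ?size_iota // nth_iota; last by lia.
by rewrite /content /=; congr pair; lia.
Qed.

Lemma annot_word_boxes n hs T j c :
  tabword n hs c (map T (boxes_from j hs)) ->
  annot_word j hs (map T (boxes_from j hs)) =
    [seq (T b, (T b)%:Z - content b)%R | b <- boxes_from j hs].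
Proof.
elim: hs j c => [|h hs IH] j c //.
rewrite map_boxes_from /= take_size_cat ?size_tcol // drop_size_cat ?size_tcol //.
by case/and3P => h1 _ h2; rewrite annot_tcol // map_cat (IH _ _ h2).
Qed.

Lemma map_tab_of p t : size t = size (boxes p) -> map (tab_of p t) (boxes p) = t.
Proof.
move=> e; apply: (@eq_from_nth _ 0); rewrite size_map // => k hk.
by rewrite (nth_map (0, 0)) // /tab_of index_uniq // uniq_boxes.
Qed.

Section ReverseTableau.
Variables (lam : seq nat) (T : box -> nat).
Hypothesis hlam : is_partition lam.

Lemma reverse_tabP : reflect
  [/\ forall b : box, b \in boxes lam -> 0 < T b,
      forall i j, 0 < i -> (i.+1, j) \in boxes lam -> T (i.+1, j) < T (i, j) &
      forall i j, 0 < j -> (i, j.+1) \in boxes lam -> T (i, j.+1) <= T (i, j)]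
  (reverse_tab lam T).
Proof.
have sub i j i' j' : 0 < i <= i' -> 0 < j <= j' -> (i', j') \in boxes lam -> (i, j) \in boxes lam.
  rewrite !mem_boxes // !in_diagE //= => hi hj /and3P[_ _ h].
  have := conj_part_le (p := lam) hlam (i := j) (j := j') ltac:(lia) ltac:(lia); lia.
apply: (iffP andP) => [[/allP h1 /allP h2]|[h1 h2 h3]].
  split=> // [i j hi hb|i j hj hb].
  - have j0 : 0 < j by move: hb; rewrite mem_boxes // in_diagE // => /and3P[].
    have := h2 (i, j) (sub i j i.+1 j ltac:(lia) ltac:(lia) hb).
    by rewrite -!mem_boxes // hb => /andP[_].
  have i0 : 0 < i by move: hb; rewrite mem_boxes // in_diagE // => /and3P[].
  have := h2 (i, j) (sub i j i j.+1 ltac:(lia) ltac:(lia) hb).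
  by rewrite -!mem_boxes // hb => /andP[].
split; first exact/allP.
apply/allP => -[i j] hb /=; move: (hb).
rewrite -!mem_boxes // [in X in X -> _]mem_boxes // in_diagE //= => /and3P[/= i0 j0 _].
by apply/andP; split; apply/implyP => hb'; [apply: h3|apply: h2].
Qed.

End ReverseTableau.

Lemma mem_boxesE p i j : is_partition p ->
  ((i, j) \in boxes p) = [&& 0 < i, 0 < j & i <= conj_part p j].
Proof. by move=> hp; rewrite mem_boxes // in_diagE. Qed.

Lemma box_col_le p (b : box) : is_partition p -> b \in boxes p -> 0 < b.2 <= part p 1.
Proof.
case: b => i j hp; rewrite mem_boxesE // => /and3P[i0 j0 hi] /=.
by rewrite j0 -conj_partE //; lia.
Qed.

Lemma tabword_reverse_tab n lam (T : box -> nat) : is_partition lam ->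
  (forall b : box, b \in boxes lam -> 0 < T b <= n) ->
  tabword n (heights lam) (iota 1 n) (map T (boxes lam)) = reverse_tab lam T.
Proof.
move=> hlam nT; rewrite boxesE /heights.
have nc j : 0 < j -> all (fun t => 0 < t <= n) (tcol T (conj_part lam j) j).
  move=> j0; apply/allP => t /mapP [i hi ->]; apply: nT.
  by rewrite mem_boxesE //; move: hi; rewrite mem_rev mem_iota; lia.
apply/tabword_boxes/(reverse_tabP T hlam) => [h|[_ h2 h3] k hk].
  split=> [b hb|i j i0 hb|i j j0 hb]; first by case/andP: (nT b hb).
    have hj := box_col_le hlam hb; have [/sorted_tcol hs _] := h j ltac:(rewrite /= in hj *; lia).
    by apply: hs; move: hb; rewrite mem_boxesE //; lia.
  have /= hj := box_col_le hlam hb.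
  have [hs hg] := h j.+1 ltac:(lia); have [hs' _] := h j ltac:(lia).
  rewrite (_ : j.+1 == 1 = false) /= in hg; last by lia.
  move: hg => /(gale_tcol hs' hs (conj_part_le hlam j0 (leqnSn j)) (nc j.+1 isT)); apply.
  by move: hb; rewrite mem_boxesE //; lia.
have sk k' : 0 < k' -> sorted ltn (tcol T (conj_part lam k') k').
  by move=> k0; apply/sorted_tcol => i hi; apply: h2; rewrite ?mem_boxesE //; lia.
split; first by apply: sk; lia.
case: eqVneq => [e|e]; first by apply: gale_iota; [apply: sk|apply: nc]; lia.
case: k hk e => [|[|k]] // hk e /=.
apply/gale_tcol; rewrite ?sk ?nc ?conj_part_le // => i hi.
by apply: h3; rewrite ?mem_boxesE //; lia.
Qed.

Definition wordof p (T : box -> nat) : seq (nat * int) :=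
  [seq (T b, (T b)%:Z - content b)%R | b <- boxes p].

Lemma tab_of_words p N t (b : box) : t \in words (size (boxes p)) N -> b \in boxes p ->
  0 < tab_of p t b <= N.
Proof.
rewrite mem_words => /andP[/eqP st /allP nt] hb; apply: nt.
by rewrite mem_nth // st index_mem.
Qed.

(** [H] is arbitrary, so that the same transfer serves [dschur] and the barred sums. *)
Lemma sum_reverse_tab (R : nmodType) n p (H : seq (nat * int) -> R) : is_partition p ->
  (\sum_(t <- words (size (boxes p)) n | reverse_tab p (tab_of p t)) H (wordof p (tab_of p t)) =
   \sum_(w <- tabs n 1 (heights p) (iota 1 n)) H w)%R.
Proof.
move=> hp; rewrite big_tabs boxesE size_boxes_from big_seq_cond [RHS]big_seq_cond.
have ht t : t \in words (sumn (heights p)) n ->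
    tabword n (heights p) (iota 1 n) t = reverse_tab p (tab_of p t).
  move=> ht; have hs : size t = size (boxes p).
    by move: ht; rewrite mem_words boxesE size_boxes_from => /andP[/eqP].
  rewrite -{1}(map_tab_of hs) tabword_reverse_tab // => b; apply: tab_of_words.
  by rewrite boxesE size_boxes_from.
apply: eq_big => [t|t /andP[h1 h2]]; first by case: (boolP (t \in _)) => //= /ht ->.
have hs : size t = size (boxes p).
  by move: h1; rewrite mem_words boxesE size_boxes_from => /andP[/eqP].
congr H; rewrite -[in RHS](map_tab_of hs) boxesE; symmetry.
rewrite /wordof [in RHS]boxesE; apply: (@annot_word_boxes n _ _ _ (iota 1 n)).
by rewrite -boxesE map_tab_of // ht.
Qed.

Lemma dschurE (R : comPzRingType) n p (x : nat -> R) a : is_partition p ->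
  dschur n p x a = tabsum a n 1 (heights p) (iota 1 n) x.
Proof.
move=> hp; rewrite /tabsum -(sum_reverse_tab n) //.
by apply: eq_bigr => t _; rewrite /wprod big_map.
Qed.

(** * Diagrams along a barred word *)

Lemma mask_take_take (m : bitseq) (A : Type) (t : seq A) k : size m = size t ->
  mask m t = mask (take k m) (take k t) ++ mask (drop k m) (drop k t).
Proof.
by move=> e; rewrite -mask_cat ?cat_take_drop // !size_take e.
Qed.

Definition state mu m (t : seq nat) k := foldl add_box mu (mask (take k m) (take k t)).

Lemma rho_ofE mu (m : bitseq) t k : size m = size t ->
  rho_of mu (mask m t) m k = state mu m t k.
Proof.
move=> e; rewrite /rho_of /rho_seq nth_cons_scanl; last first.
  by rewrite size_mask // -[in X in _ <= X](cat_take_drop k m) count_cat leq_addr.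
congr foldl; rewrite (mask_take_take k e) take_size_cat // size_mask //.
by rewrite !size_take e.
Qed.

Lemma last_scanl mu r : last mu (scanl add_box mu r) = foldl add_box mu r.
Proof. by elim: r mu => //= t r IH mu. Qed.

Section Path.
Variables (mu nu : seq nat) (m : bitseq) (t : seq nat).
Hypotheses (hmu : is_partition mu) (emt : size m = size t) (t0 : all (fun u => 0 < u) t).
Hypothesis hyam : yam_ok mu nu (mask m t).

Lemma path_partition k : is_partition (state mu m t k).
Proof.
rewrite -rho_ofE // /rho_of.
have hall : all is_partition (rho_seq mu (mask m t)) by rewrite /= hmu; case/andP: hyam.
(* Out of range, the default [[::]] is a partition too. *)
case: (ltnP (count id (take k m)) (size (rho_seq mu (mask m t)))) => h; last by rewrite nth_default.
by apply: (allP hall); rewrite mem_nth.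
Qed.

Lemma path_final : foldl add_box mu (mask m t) = nu.
Proof. by case/andP: hyam => _ /eqP <-; rewrite last_scanl. Qed.

Lemma path_size : sumn nu = sumn mu + size (mask m t).
Proof. by rewrite -path_final sumn_foldl. Qed.

Lemma part_final u : 0 < u -> part nu u = part mu u + count_mem u (mask m t).
Proof.
by move=> u0; rewrite -path_final part_foldl // all_mask.
Qed.

Lemma part_state k u : 0 < u ->
  part (state mu m t k) u = part mu u + count_mem u (mask (take k m) (take k t)).
Proof.
move=> u0; rewrite part_foldl //; apply: all_mask.
by move: t0; rewrite -{1}(cat_take_drop k t) all_cat => /andP[].
Qed.

Lemma part_state_mono k l u : 0 < u -> k <= l ->
  part (state mu m t k) u <= part (state mu m t l) u.
Proof.
move=> u0 hkl; rewrite !part_state // leq_add2l.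
rewrite (@mask_take_take (take l m) _ (take l t) k); last by rewrite !size_take emt.
by rewrite !take_takel // count_cat leq_addr.
Qed.

Lemma part_state_le k u : 0 < u -> part (state mu m t k) u <= part nu u.
Proof.
move=> u0; rewrite part_state // part_final // leq_add2l.
by rewrite (mask_take_take k emt) count_cat leq_addr.
Qed.

Lemma part_state_barred k : k < size t -> nth false m k ->
  part (state mu m t k.+1) (nth 0 t k) = (part (state mu m t k) (nth 0 t k)).+1.
Proof.
move=> hk mk; have u0 : 0 < nth 0 t k by apply: (allP t0); rewrite mem_nth.
rewrite !part_state // (take_nth false) ?emt // (take_nth 0) // -!cats1 mask_cat ?size_take ?emt //.
by rewrite mk count_cat /= eqxx addn0 addn1 addnS.
Qed.

(** From the unbarred letter [k] on, row [u] gains at most one box for each later letter [u]. *)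
Lemma part_final_unbarred k u : k < size t -> ~~ nth false m k -> 0 < u ->
  part nu u <= part (state mu m t k) u + count_mem u (drop k.+1 t).
Proof.
move=> hk mk u0; rewrite part_final // part_state // (mask_take_take k emt) count_cat -addnA.
rewrite !leq_add2l (drop_nth false) ?emt // (drop_nth 0) // (negbTE mk) /=.
exact/leq_count_subseq/mask_subseq.
Qed.

Lemma subdiag_path : subdiag mu nu.
Proof.
apply/allP => k; rewrite mem_iota => /andP[k0 _].
by rewrite part_final // leq_addr.
Qed.

End Path.

(** * Barred tableaux *)

Section BarredTableau.
Variables (lam : seq nat) (T : box -> nat).
Hypotheses (hlam : is_partition lam) (hT : reverse_tab lam T).
Notation bs := (boxes lam).
Notation t := (map T (boxes lam)).

Lemma tab_pos (b : box) : b \in bs -> 0 < T b.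
Proof. by case/(reverse_tabP T hlam): hT => h _ _; apply: h. Qed.

Lemma tab_all_pos : all (fun u => 0 < u) t.
Proof. by apply/allP => u /mapP [b hb ->]; exact: tab_pos. Qed.

Lemma tab_col (i j k : nat) : 0 < i -> (i + k, j) \in bs -> T (i + k, j) + k <= T (i, j).
Proof.
move=> i0; elim: k => [|k IH] hb; first by rewrite !addn0.
case/(reverse_tabP T hlam): hT => _ h _.
have hb' : (i + k, j) \in bs by move: hb; rewrite !mem_boxesE //; lia.
move: hb; rewrite (addnS i) => hb.
by apply: leq_trans (IH hb'); rewrite !addnS -addSn leq_add2r; apply: h => //; lia.
Qed.

Lemma tab_top (b : box) : b \in bs -> T b + b.1.-1 <= T (1, b.2).
Proof.
case: b => i j hb; move: (hb); rewrite mem_boxesE // => /and3P[i0 _ _].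
have := @tab_col 1 j i.-1 isT; rewrite add1n prednK //=; exact.
Qed.

Lemma tab_col_inj (b b' : box) : b \in bs -> b' \in bs -> T b = T b' -> b.2 = b'.2 -> b = b'.
Proof.
case: b b' => [i j] [i' j'] hb hb' e /= ej; subst j'; congr pair.
wlog hi : i i' hb hb' e / i <= i'.
  move=> H; case: (leqP i i') => h; first exact: H.
  by symmetry; apply: H => //; lia.
have i0 : 0 < i by move: hb; rewrite mem_boxesE // => /and3P[].
have := @tab_col i j (i' - i) i0; rewrite subnKC // => /(_ hb'); lia.
Qed.

Lemma tab_row1 (j : nat) : 0 < j -> (1, j.+1) \in bs -> T (1, j.+1) <= T (1, j).
Proof. by case/(reverse_tabP T hlam): hT => _ _ h; apply: h. Qed.

Lemma nth_boxes_col k l : k <= l -> l < size bs ->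
  (nth (0, 0) bs k).2 <= (nth (0, 0) bs l).2.
Proof.
rewrite leq_eqVlt => /orP[/eqP -> //|hkl] hl.
have := boxes_from_pairwise 1 (heights lam); rewrite -boxesE => /(pairwiseP (0, 0)).
by apply=> //; exact: ltn_trans hkl hl.
Qed.

(** Strict decrease down columns puts equal entries in distinct columns, so counting column numbers
    suffices. *)
Lemma count_entry_cols (s : seq box) u lo hi : uniq s -> {subset s <= bs} ->
  (forall b : box, b \in s -> T b = u -> lo <= b.2 < hi) ->
  count (fun b => T b == u) s <= hi - lo.
Proof.
move=> us sub h; rewrite -size_filter -(size_map snd) -[X in _ <= X](size_iota lo).
apply: uniq_leq_size.
  rewrite map_inj_in_uniq ?filter_uniq // => b b'.
  rewrite !mem_filter => /andP[/eqP e1 h1] /andP[/eqP e2 h2]; apply: tab_col_inj.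
  - exact: sub.
  - exact: sub.
  by rewrite e1.
move=> j /mapP [b]; rewrite mem_filter => /andP[/eqP e hb] ->.
rewrite mem_iota; case/andP: (h b hb e) => h1 h2.
by rewrite h1 subnKC //; exact: ltnW (leq_ltn_trans h1 h2).
Qed.

Lemma count_mem_entries u (s : seq box) :
  count_mem u (map T s) = count (fun b => T b == u) s.
Proof. by rewrite count_map. Qed.

Lemma count_entry_before k : k < size bs ->
  let b := nth (0, 0) bs k in count_mem (T b) (take k t) < b.2.
Proof.
move=> hk /=; set b : box := nth _ _ k; have hb : b \in bs by rewrite mem_nth.
have := @count_entry_cols (take k.+1 bs) (T b) 1 b.2.+1.
rewrite take_uniq ?uniq_boxes // => /(_ isT (@mem_take _ _ _)) h.
rewrite -map_take count_mem_entries.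
have : count (fun b' => T b' == T b) (take k.+1 bs) <= b.2.+1 - 1.
  apply: h => b' hb' _; have hc := box_col_le hlam (mem_take hb').
  rewrite ltnS; move: hb' hc => /(nthP (0, 0)) [i]; rewrite size_takel // => hi.
  rewrite nth_take // => <- /andP[-> _] /=; apply: nth_boxes_col; lia.
by rewrite (take_nth (0, 0)) // -cats1 count_cat /= eqxx addn0 addn1 subn1.
Qed.

Section Path.
Variables (mu nu : seq nat) (m : bitseq).
Hypotheses (hnu : is_partition nu) (sm : size m = size bs).
Hypothesis hyam : yam_ok mu nu (mask m t).

Let smt : size m = size t. Proof. by rewrite size_map. Qed.
Let nth_t k : k < size bs -> nth 0 t k = T (nth (0, 0) bs k).
Proof. by move=> hk; rewrite (nth_map (0, 0)). Qed.

(* The entries equal to [T b] read from [b] on lie in distinct columns, which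
   boundedness confines to [b.2 .. nu_(T b)]; hence at most [nu_(T b) - b.2]
   boxes are added to row [T b] after [b]. *)
Lemma unbarred_bound k : nu_bounded lam nu T -> k < size bs -> ~~ nth false m k ->
  let b := nth (0, 0) bs k in b.2 <= part (state mu m t k) (T b).
Proof.
move=> hbd hk mk /=; set b : box := nth _ _ k; have hb : b \in bs by rewrite mem_nth.
have u0 := tab_pos hb.
(* An entry is at most the top entry of its column, hence at most the height of that column in
   [nu]. *)
have hcol (b' : box) : b' \in bs -> T b' = T b -> b'.2 <= part nu (T b).
  move=> hb' e; have := allP hbd b'.2; rewrite mem_iota => /(_ _) h.
  have hc := box_col_le hlam hb'.
  rewrite -conj_partE //; last by lia.
  apply: leq_trans (h _); last by lia.
  by rewrite -e; apply: leq_trans (tab_top hb'); exact: leq_addr.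
have := part_final_unbarred smt tab_all_pos hyam (k := k) (u := T b).
rewrite size_map => /(_ hk mk u0); rewrite -map_drop count_mem_entries.
have := @count_entry_cols (drop k bs) (T b) b.2 (part nu (T b)).+1.
rewrite drop_uniq ?uniq_boxes // => /(_ isT (@mem_drop _ _ _)).
rewrite (drop_nth (0, 0)) // -/b /= eqxx => /(_ _) h.
have := hcol b hb erefl; have : 1 + count (fun b' => T b' == T b) (drop k.+1 bs) <= (part nu (T b)).+1 - b.2.
  apply: h => b' hb' e; have hb'' : b' \in bs.
    by apply: (mem_drop (n0 := k)); rewrite (drop_nth (0, 0)).
  rewrite ltnS hcol // andbT; move: hb'; rewrite -/b -(drop_nth (0,0)) // => /(nthP (0, 0)) [i].
  by rewrite size_drop ltn_subRL nth_drop => hi <-; apply: nth_boxes_col => //; exact: leq_addr.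
lia.
Qed.

Hypothesis hmu : is_partition mu.

(* If no factor vanishes, then after reading box (1,j) row [T (1,j)] of the
   current diagram has at least [j] boxes. *)
Lemma nonzero_bounded :
  (forall k, k < size bs -> ~~ nth false m k ->
     ((part (state mu m t k) (T (nth (0, 0) bs k)))%:Z != content (nth (0, 0) bs k))%R) ->
  nu_bounded lam nu T.
Proof.
move=> hnz.
have h1 j : 0 < j <= part lam 1 -> (1, j) \in bs.
  by move=> hj; rewrite mem_boxesE // conj_partE //; lia.
pose pos j := index (1, j) bs.
have hpos j : 0 < j <= part lam 1 -> pos j < size bs by move=> /h1; rewrite index_mem.
have npos j : 0 < j <= part lam 1 -> nth (0, 0) bs (pos j) = (1, j).
  by move=> /h1 h; rewrite nth_index.
have H j : 0 < j <= part lam 1 -> j <= part (state mu m t (pos j).+1) (T (1, j)).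
  elim: j => // j IH hj.
  have u0 := tab_pos (h1 _ hj); have hk := hpos _ hj; have ek := npos _ hj.
  (* As [T (1, j+1) <= T (1, j)], row [T (1, j+1)] is at least as long as row [T (1, j)], which has
     [j] boxes once box [(1, j)] is read. *)
  have hpre : j <= part (state mu m t (pos j.+1)) (T (1, j.+1)).
    case: (posnP j) => [-> //|j0]; have hj' : 0 < j <= part lam 1 by lia.
    apply: leq_trans (IH hj') _.
    apply: leq_trans (part_homo (path_partition hmu smt hyam _) u0 (tab_row1 j0 (h1 _ hj))).
    apply: (part_state_mono mu smt tab_all_pos); first exact: tab_pos (h1 _ hj').
    rewrite ltnNge; apply/negP => hle; have := nth_boxes_col hle (hpos _ hj').
    by rewrite !npos //= ltnn.
  case mk : (nth false m (pos j.+1)).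
    have := part_state_barred mu smt tab_all_pos (k := pos j.+1).
    by rewrite size_map nth_t // ek => /(_ hk mk) ->.
  (* The content of [(1, j+1)] is [j], so a nonzero factor excludes the length [j]. *)
  have := hnz _ hk (negbT mk); rewrite ek /content /= => hne.
  apply: leq_trans (part_state_mono mu smt tab_all_pos u0 (leqnSn _)); lia.
apply/allP => j; rewrite mem_iota => hj; have hj' : 0 < j <= part lam 1 by lia.
have u0 := tab_pos (h1 _ hj').
rewrite conj_partE //; last by lia.
exact: leq_trans (H j hj') (part_state_le smt tab_all_pos hyam _ u0).
Qed.

End Path.

Lemma tab_le_size nu (b : box) : nu_bounded lam nu T -> b \in bs -> T b <= size nu.
Proof.
move=> hbd hb; have hc := box_col_le hlam hb.
have := allP hbd b.2; rewrite mem_iota => /(_ ltac:(lia)) h.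
have := tab_top hb; have : conj_part nu b.2 <= size nu by apply: count_size.
lia.
Qed.

(* For [mu] empty, row [T b] of the diagram before [b] counts earlier entries
   [T b], which occupy columns left of [b]: this contradicts [unbarred_bound]. *)
Lemma empty_path_all_barred nu m : is_partition nu -> size m = size bs ->
  yam_ok [::] nu (mask m t) -> nu_bounded lam nu T -> m = nseq (size bs) true.
Proof.
move=> hnu sm hy hbd; apply: (@eq_from_nth _ false); first by rewrite size_nseq.
rewrite sm => k hk; rewrite nth_nseq hk; case: (boolP (nth false m k)) => // mk; exfalso.
have smt : size m = size t by rewrite size_map.
have := @unbarred_bound [::] nu m hnu sm hy k hbd hk mk; have := count_entry_before hk.
have u0 : 0 < T (nth (0, 0) bs k) by apply: tab_pos; rewrite mem_nth.
rewrite /= part_state //; last exact: tab_all_pos.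
rewrite /part nth_nil add0n.
have h3 := leq_count_subseq (pred1 (T (nth (0, 0) bs k))) (mask_subseq (take k m) (take k t)).
by move=> h1 h2; have := leq_ltn_trans (leq_trans h2 h3) h1; rewrite ltnn.
Qed.

(** The chain [lam'_j <= T (1, j) <= nu'_j] puts [lam] inside [nu], and equal sizes force equality.
    The top entry of each column is then its height, which determines the column. *)
Lemma empty_path_shape nu : is_partition nu -> sumn nu = sumn lam ->
  nu_bounded lam nu T ->
  nu = lam /\ forall b : box, b \in bs -> T b = (conj_part lam b.2).+1 - b.1.
Proof.
move=> hnu hs hbd.
have hle j : 0 < j <= part lam 1 -> conj_part lam j <= T (1, j) <= conj_part nu j.
  move=> hj; have -> : T (1, j) <= conj_part nu j by apply: (allP hbd); rewrite mem_iota; lia.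
  rewrite andbT.
  have hb : (conj_part lam j, j) \in bs.
    by rewrite mem_boxesE // leqnn conj_partE //; lia.
  by have := tab_top hb; have := tab_pos hb; rewrite /=; lia.
have hsub k : 0 < k -> part lam k <= part nu k.
  move=> k0; case: (posnP (part lam k)) => [-> //|p0].
  rewrite -conj_partE //; have := hle (part lam k); rewrite p0 (part_homo hlam) //.
  have : k <= conj_part lam (part lam k) by rewrite conj_partE.
  by move=> h /(_ isT); lia.
have e : nu = lam.
  apply: part_inj => // k k0.
  have hsz : size lam <= size nu.
    case: (posnP (size lam)) => [-> //|l0]; rewrite -(part_pos hnu) //.
    by apply: leq_trans (hsub _ l0); rewrite part_pos.
  have sumE p M : size p <= M -> sumn p = \sum_(i < M) part p i.+1.
    move=> hM; rewrite sumnE (big_nth 0) big_mkord (big_ord_widen _ (nth 0 p) hM) big_mkcond.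
    by apply: eq_bigr => i _; case: ltnP => // hi; rewrite /part nth_default.
  case: (ltnP k.-1 (size nu)) => hk; last first.
    by rewrite /part !nth_default //; lia.
  have := hs; rewrite (sumE nu (size nu)) // (sumE lam (size nu)) //.
  move/eqP; rewrite eq_sym (eqn_leq (\sum_(i < _) part lam _)).
  case/andP=> _; rewrite leqNgt; apply: contraNeq => hne.
  rewrite (bigD1 (Ordinal hk)) //= [X in _ < X](bigD1 (Ordinal hk)) //= prednK //.
  rewrite -addSn leq_add //; first by have := hsub k k0; lia.
  by apply: leq_sum => i _; apply: hsub.
split=> // -[i j] hb /=; rewrite e in hle.
have hj := hle j (box_col_le hlam hb).
move: (hb); rewrite mem_boxesE // => /and3P[i0 j0 hi].
have := tab_top hb; have hb' : (i + (conj_part lam j - i), j) \in bs.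
  by rewrite subnKC // mem_boxesE // leqnn; lia.
have := tab_col i0 hb'; have := tab_pos hb'; rewrite /=; lia.
Qed.

End BarredTableau.

(** * The formula as a sum over barred words *)

Lemma mem_parts_upto n B p :
  (p \in parts_upto n B) = [&& is_partition p, size p <= n & sumn p <= B].
Proof.
apply/flatten_mapP/and3P => [[k]|[h1 h2 h3]].
  rewrite mem_iota mem_filter mem_words => /andP[_ hk] /andP[/andP[-> ->] /andP[/eqP -> _]].
  by split=> //; lia.
exists (size p); first by rewrite mem_iota; lia.
rewrite mem_filter h1 h3 mem_words eqxx /=; apply/allP => y hy.
case/is_partitionP: h1 => _ h0; apply/andP; split.
  by rewrite lt0n; apply: contra h0 => /eqP <-.
by apply: leq_trans h3; rewrite sumnE (big_rem y) //= leq_addr.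
Qed.

Lemma uniq_parts_upto n B : uniq (parts_upto n B).
Proof.
rewrite /parts_upto; elim: (iota 0 n.+1) (iota_uniq 0 n.+1) => //= k ks IH /andP[hk /IH us].
rewrite cat_uniq us andbT filter_uniq ?uniq_words //=.
apply/hasPn => p /flatten_mapP [l hl]; rewrite !mem_filter !mem_words.
case/andP=> _ /andP[/eqP sl _]; apply/negP => /andP[_ /andP[/eqP sk _]].
by move: hk; rewrite -sk sl hl.
Qed.

Section MaskSums.
Variables (R : comPzRingType) (a : int -> R).
Local Open Scope ring_scope.

Definition mask_weight mu (m : seq bool) (t : seq nat) (idx : seq int) : R :=
  \prod_(k <- iota 0 (size t) | ~~ nth false m k)
    (a ((nth 0%N t k)%:Z - (part (state mu m t k) (nth 0%N t k))%:Z) - a (nth 0 idx k)).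

Lemma walk_masks F p t idx : size idx = size t ->
  \sum_(m <- bwords (size t))
     (if all is_partition (scanl add_box p (mask m t))
      then mask_weight p m t idx * F (foldl add_box p (mask m t)) else 0) =
  walk a F p (zip t idx).
Proof.
elim: t idx p => [|u t IH] [|i idx] p //=.
  by move=> _; rewrite big_seq1 /mask_weight /= big_nil mul1r.
move=> [si]; rewrite cats0 big_cat !big_map /=.
have iotaS N : iota 1 N = map S (iota 0 N) by rewrite -[1%N]addn0 iotaDl.
congr (_ + _).
  case: ifP => hp; last by rewrite big1.
  rewrite -(IH idx) //; apply: eq_bigr => m _ /=; case: ifP => // _; congr (_ * _).
  by rewrite /mask_weight /= big_cons /= iotaS big_map.
rewrite -(IH idx) // mulr_sumr; apply: eq_bigr => m _; case: ifP => // _; last by rewrite mulr0.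
by rewrite mulrA; congr (_ * _); rewrite /mask_weight /= big_cons /= iotaS big_map.
Qed.

Variables lam mu nu : seq nat.
Hypotheses (hlam : is_partition lam) (hmu : is_partition mu) (hnu : is_partition nu).
Notation bs := (boxes lam).

Definition indices (T : box -> nat) : seq int := [seq (T b)%:Z - content b | b <- bs].

(** The Yamanouchi symbol is [mask m t], so the sum over [r] collapses; a valid symbol forces [mu]
    inside [nu], which accounts for the zero branch. *)
Lemma LRformula_masks :
  LRformula lam mu nu a =
  \sum_(t <- words (size bs) (size nu) |
        reverse_tab lam (tab_of lam t) && nu_bounded lam nu (tab_of lam t))
   \sum_(m <- bwords (size bs))
     (if yam_ok mu nu (mask m t) then mask_weight mu m t (indices (tab_of lam t)) else 0).
Proof.
rewrite /LRformula; case: ifP => hsub; last first.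
  rewrite big_seq_cond big1 // => t /andP[]; rewrite mem_words => /andP[/eqP st nt] _.
  rewrite big_seq big1 // => m; rewrite mem_bwords => /eqP sm; case: ifP => // hy.
  have nt' : all (fun u => 0 < u)%N t by apply: sub_all nt => u /andP[].
  by rewrite (subdiag_path nt' hy) in hsub.
rewrite exchange_big /= big_seq_cond [RHS]big_seq_cond; apply: eq_bigr => t /andP[ht _].
move: (ht); rewrite mem_words => /andP[/eqP st nt].
have et := map_tab_of st; have sT : size (map (tab_of lam t) bs) = size t by rewrite et.
rewrite (exchange_big_dep predT) //= big_seq [RHS]big_seq; apply: eq_bigr => m.
rewrite mem_bwords => /eqP sm.
have smt : size m = size t by rewrite sm st.
rewrite (eq_bigl (fun r => yam_ok mu nu r && (r == mask m t))); last first.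
  by move=> r; rewrite /barred_ok sm eqxx /= map_mask et eq_sym.
rewrite -big_filter; case: ifP => hy; last first.
  rewrite big_filter big1 // => r /andP[h /eqP e]; by rewrite -e h in hy.
rewrite (perm_big [:: mask m t]); last first.
  apply: uniq_perm => //; first exact/filter_uniq/uniq_words.
  move=> r; rewrite mem_filter inE; case: eqP => [->|]; rewrite ?andbF // hy /=.
  rewrite mem_words (path_size hy) addKn eqxx /=.
  exact: all_mask.
rewrite big_seq1 /mask_weight st big_seq_cond [RHS]big_seq_cond.
apply: eq_bigr => k /andP[]; rewrite mem_iota add0n => /andP[_ hk] _.
rewrite -!rho_ofE // /indices (nth_map (0%N, 0%N)) //.
by have -> : nth 0%N t k = tab_of lam t (nth (0%N, 0%N) bs k) by rewrite -{1}et (nth_map (0%N, 0%N)).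
Qed.

(** By contraposition of [nonzero_bounded], some unbarred box has row length equal to its content,
    and its two terms of [a] cancel. *)
Lemma mask_weight_unbounded m t : size t = size bs -> size m = size t ->
  reverse_tab lam (tab_of lam t) -> ~~ nu_bounded lam nu (tab_of lam t) ->
  yam_ok mu nu (mask m t) -> mask_weight mu m t (indices (tab_of lam t)) = 0.
Proof.
move=> st sm hrev hbd hy; have et := map_tab_of st.
have sm' : size m = size bs by rewrite sm.
set T := tab_of lam t in hrev hbd et *.
have nt k : (k < size bs)%N -> nth 0%N t k = T (nth (0%N, 0%N) bs k).
  by move=> hk; rewrite -et (nth_map (0%N, 0%N)).
pose bad k := ~~ nth false m k && ((part (state mu m t k) (nth 0%N t k))%:Z == content (nth (0%N, 0%N) bs k)).
case: (boolP (has bad (iota 0 (size t)))) => [/hasP [k hk /andP[mk /eqP e]]|/hasPn h].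
  rewrite /mask_weight (big_rem k) //= mk e /indices.
  move: hk; rewrite mem_iota add0n st => /andP[_ hk].
  by rewrite (nth_map (0%N, 0%N)) // nt // subrr mul0r.
case/negP: hbd; apply: (nonzero_bounded hlam hrev hnu sm' _ hmu).
  by rewrite et.
move=> k hk mk; rewrite et -nt //; apply/negP => /eqP e.
by have := h k; rewrite mem_iota add0n st hk => /(_ isT); rewrite /bad mk e eqxx.
Qed.

(** Makes the range of tableaux independent of [nu], so that it can be exchanged with a sum over
    [nu]. *)
Lemma LRformula_unbounded n : (size nu <= n)%N ->
  LRformula lam mu nu a =
  \sum_(t <- words (size bs) n | reverse_tab lam (tab_of lam t))
   \sum_(m <- bwords (size bs))
     (if yam_ok mu nu (mask m t) then mask_weight mu m t (indices (tab_of lam t)) else 0).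
Proof.
move=> hn; rewrite LRformula_masks [RHS](bigID (fun t => nu_bounded lam nu (tab_of lam t))) /=.
rewrite [X in _ + X]big_seq_cond [X in _ + X]big1 ?addr0; last first.
  move=> t /andP[]; rewrite mem_words => /andP[/eqP st _] /andP[hr hb].
  rewrite big_seq big1 // => m; rewrite mem_bwords -st => /eqP sm.
  by case: ifP => // hy; apply: mask_weight_unbounded.
rewrite -big_filter -[RHS]big_filter; apply: perm_big; apply: uniq_perm.
- exact/filter_uniq/uniq_words.
- exact/filter_uniq/uniq_words.
move=> t; rewrite !mem_filter !mem_words.
case: (boolP (reverse_tab _ _)) => //= hr; case: (boolP (nu_bounded _ _ _)) => //= hb.
case: (size t =P size bs) => //= st.
apply/allP/allP => h u hu; first by have := h u hu; lia.
have := h u hu; move: hu; rewrite -{1}(map_tab_of st) => /mapP [b hb' ->].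
by have := tab_le_size hlam hr hb hb'; lia.
Qed.

End MaskSums.

(** * Summation over the final diagrams *)

Section Expansion.
Variables (R : comPzRingType) (a : int -> R) (n : nat).
Local Open Scope ring_scope.

(** A tableau with a mask ends at one diagram only, so the sum over [nu] selects that end. *)
Lemma sum_LRformula lam mu (F : seq nat -> R) :
  is_partition lam -> is_partition mu -> (size mu <= n)%N ->
  \sum_(nu <- parts_upto n (sumn lam + sumn mu)) LRformula lam mu nu a * F nu =
  \sum_(w <- tabs n 1 (heights lam) (iota 1 n)) walk a F mu w.
Proof.
move=> hlam hmu hn; rewrite -sum_reverse_tab //.
transitivity (\sum_(nu <- parts_upto n (sumn lam + sumn mu))
  \sum_(t <- words (size (boxes lam)) n | reverse_tab lam (tab_of lam t))
  \sum_(m <- bwords (size (boxes lam)))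
     (if yam_ok mu nu (mask m t) then mask_weight a mu m t (indices lam (tab_of lam t)) else 0) * F nu).
  rewrite big_seq [RHS]big_seq; apply: eq_bigr => nu; rewrite mem_parts_upto => /and3P[h1 h2 _].
  rewrite (LRformula_unbounded a hlam hmu h1 h2) mulr_suml.
  by apply: eq_bigr => t _; rewrite mulr_suml.
rewrite exchange_big /= big_seq_cond [RHS]big_seq_cond; apply: eq_bigr => t /andP[ht _].
move: (ht); rewrite mem_words => /andP[/eqP st nt].
have -> : wordof lam (tab_of lam t) = zip t (indices lam (tab_of lam t)).
  by rewrite -{2}(map_tab_of st) zip_map.
rewrite -walk_masks; last by rewrite size_map.
rewrite exchange_big /= st big_seq [RHS]big_seq; apply: eq_bigr => m.
rewrite mem_bwords => /eqP sm.
set r := mask m t; have hr : all (fun u => 0 < u <= n)%N r by exact: all_mask.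
case: ifP => hall; last first.
  by rewrite big1 // => nu _; rewrite /yam_ok hall mul0r.
have hin : foldl add_box mu r \in parts_upto n (sumn lam + sumn mu).
  rewrite mem_parts_upto size_foldl_le // sumn_foldl -last_scanl; apply/and3P; split=> //.
    by have := mem_last mu (scanl add_box mu r); rewrite inE => /predU1P[-> //|]; apply: (allP hall).
  rewrite addnC leq_add2r -(size_boxes hlam) -st; exact: size_subseq (mask_subseq _ _).
rewrite (bigD1_seq _ hin (uniq_parts_upto _ _)) /= /yam_ok hall last_scanl eqxx /= big1 ?addr0 //.
by move=> nu hne; rewrite eq_sym (negbTE hne) mul0r.
Qed.

End Expansion.

(** * The bialternant formula and the expansion *)

Section Superstandard.
Variable lam : seq nat.
Hypothesis hlam : is_partition lam.

(** Each column reads [1, 2, ..., h]; this tableau alone contributes when [mu] is empty. *)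
Definition super_tab (b : box) := (conj_part lam b.2).+1 - b.1.

Definition super_word := map super_tab (boxes lam).

Lemma super_wordE : super_word = flatten [seq iota 1 h | h <- heights lam].
Proof.
rewrite /super_word boxesE /heights.
have H M j : map super_tab (boxes_from j (map (conj_part lam) (iota j M))) =
    flatten [seq iota 1 h | h <- map (conj_part lam) (iota j M)].
  elim: M j => //= M IH j; rewrite map_cat IH; congr (_ ++ _).
  apply: (@eq_from_nth _ 0) => [|i]; rewrite !size_map size_rev !size_iota // => hi.
  rewrite (nth_map (0, 0)) ?size_map ?size_rev ?size_iota //.
  rewrite (nth_map 0) ?size_rev ?size_iota // nth_rev ?size_iota // /super_tab /=.
  by rewrite !nth_iota; lia.
exact: H.
Qed.

Lemma super_tab_pos (b : box) : b \in boxes lam -> 0 < super_tab b <= size lam.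
Proof.
case: b => i j; rewrite mem_boxesE // /super_tab /= => /and3P[i0 j0 hi].
have : conj_part lam j <= size lam by apply: count_size.
lia.
Qed.

Lemma eq_reverse_tab T T' : {in boxes lam, T =1 T'} ->
  reverse_tab lam T = reverse_tab lam T'.
Proof.
wlog suff H : T T' / {in boxes lam, T =1 T'} -> reverse_tab lam T -> reverse_tab lam T'.
  by move=> e; apply/idP/idP; apply: H => // b hb; rewrite e.
move=> e /(reverse_tabP T hlam) [h1 h2 h3]; apply/(reverse_tabP T' hlam); split.
- by move=> b hb; rewrite -e // h1.
- move=> i j i0 hb; rewrite -!e //; first exact: h2.
  by move: hb; rewrite !mem_boxesE // => /and3P[_ -> h]; rewrite i0 ltnW.
- move=> i j j0 hb; rewrite -!e //; first exact: h3.
  move: hb; rewrite !mem_boxesE // => /and3P[-> _ h]; rewrite j0 /=.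
  exact: leq_trans h (conj_part_le hlam j0 (leqnSn j)).
Qed.

Lemma super_reverse_tab : reverse_tab lam super_tab.
Proof.
apply/(reverse_tabP _ hlam); split=> [b /super_tab_pos /andP[] //|i j i0|i j j0].
  by rewrite mem_boxesE // => /and3P[_ _ h]; rewrite /super_tab /=; lia.
move=> _; rewrite /super_tab /=.
by have := conj_part_le hlam j0 (leqnSn j); lia.
Qed.

(** Once row [k] has grown, row [k+1] is strictly shorter and can receive the next box. *)
Lemma partition_column p k h : is_partition p -> 0 < k ->
  (k = 1 \/ part p k < part p k.-1) ->
  all is_partition (scanl add_box p (iota k h)).
Proof.
elim: h p k => //= h IH p k hp k0 hk.
have hp' : is_partition (add_box p k).
  case: (boolP (is_partition _)) => // /(not_partition_add_box hp k0) []; lia.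
rewrite hp' /=; apply: IH => //; right.
rewrite !part_add_box // eqxx (_ : k == k.+1 = false); last by lia.
by have := part_homo hp k0 (leqnSn k); rewrite /=; lia.
Qed.

Lemma partition_columns p hs : is_partition p ->
  all is_partition (scanl add_box p (flatten [seq iota 1 h | h <- hs])).
Proof.
elim: hs p => //= h hs IH p hp; rewrite scanl_cat all_cat.
have hc := partition_column (p := p) (k := 1) h hp isT (or_introl erefl).
rewrite hc /=; apply: IH; rewrite -last_scanl.
by have := mem_last p (scanl add_box p (iota 1 h)); rewrite inE => /predU1P[-> //|]; apply: (allP hc).
Qed.

Lemma yam_super : yam_ok [::] lam super_word.
Proof.
rewrite /yam_ok super_wordE partition_columns //= last_scanl.
have hall : all (fun t => 0 < t) (flatten [seq iota 1 h | h <- heights lam]).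
  by apply/allP => u /flatten_mapP [h _]; rewrite mem_iota => /andP[].
have := partition_columns (p := [::]) (heights lam) isT.
rewrite -last_scanl => hc; apply/eqP/part_inj => // [|u u0].
  have := mem_last [::] (scanl add_box [::] (flatten [seq iota 1 h | h <- heights lam])).
  by rewrite inE => /predU1P[-> //|]; apply: (allP hc).
rewrite last_scanl part_foldl // {1}/part nth_nil add0n count_flatten -map_comp.
rewrite (eq_map (g := fun h => (u <= h) : nat)); last first.
  move=> h /=; rewrite count_uniq_mem ?iota_uniq // mem_iota u0 /= add1n ltnS //.
rewrite sumn_count /heights count_map -[RHS](minn_idPl (part_homo hlam (isT : 0 < 1) u0)).
rewrite -count_iota_leq; apply: eq_in_count => j; rewrite mem_iota => hj /=.
by rewrite conj_partE //; lia.
Qed.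

Lemma super_bounded : nu_bounded lam lam super_tab.
Proof. by apply/allP => j _; rewrite /super_tab /= subn1. Qed.

End Superstandard.

Lemma LRformula_empty (R : comPzRingType) (a : int -> R) lam nu :
  is_partition lam -> is_partition nu ->
  LRformula lam [::] nu a = (nu == lam)%:R%R.
Proof.
move=> hlam hnu; rewrite LRformula_masks //.
set N := size (boxes lam).
have key t m : t \in words N (size nu) -> reverse_tab lam (tab_of lam t) ->
    nu_bounded lam nu (tab_of lam t) -> m \in bwords N -> yam_ok [::] nu (mask m t) ->
    [/\ m = nseq N true, nu = lam & t = super_word lam].
  rewrite mem_words mem_bwords => /andP[/eqP st _] hr hb /eqP sm hy.
  have et := map_tab_of st; rewrite -et in hy.
  have em := empty_path_all_barred hlam hr hnu sm hy hb.
  have es : sumn nu = sumn lam.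
    by rewrite (path_size hy) em mask_true ?size_map // size_boxes.
  have [en h] := empty_path_shape hlam hr hnu es hb.
  by split=> //; rewrite -et; apply/eq_in_map => b hb'; rewrite h.
case: eqP => [e|hne]; last first.
  rewrite big_seq_cond big1 // => t /andP[ht /andP[hr hb]].
  rewrite big_seq big1 // => m hm; case: ifP => // hy.
  by case: (key t m ht hr hb hm hy).
subst nu.
have st : size (super_word lam) = N by rewrite size_map.
have ht0 : super_word lam \in words N (size lam).
  rewrite mem_words st eqxx; apply/allP => u /mapP [b hb ->]; exact: super_tab_pos.
have eT : {in boxes lam, tab_of lam (super_word lam) =1 super_tab lam}.
  by apply/eq_in_map; rewrite map_tab_of.
have hr0 : reverse_tab lam (tab_of lam (super_word lam)).
  by rewrite (eq_reverse_tab hlam eT) super_reverse_tab.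
have hb0 : nu_bounded lam lam (tab_of lam (super_word lam)).
  apply/allP => j hj; rewrite eT ?(allP (super_bounded lam)) //.
  by move: hj; rewrite mem_iota => hj; rewrite mem_boxesE // conj_partE //; lia.
rewrite big_mkcond (bigD1_seq _ ht0 (uniq_words _ _)) /= hr0 hb0 /=.
have hm0 : nseq N true \in bwords N by rewrite mem_bwords size_nseq.
rewrite [X in (_ + X)%R]big_seq_cond [X in (_ + X)%R]big1 ?addr0; last first.
  move=> t /andP[ht ne]; case: ifP => // /andP[hr hb].
  rewrite big_seq big1 // => m hm; case: ifP => // hy.
  by case: (key t m ht hr hb hm hy) => _ _ e; rewrite e eqxx in ne.
rewrite (bigD1_seq _ hm0 (uniq_bwords _)) /= mask_true ?st // yam_super //.
rewrite [X in (_ + X)%R]big_seq_cond [X in (_ + X)%R]big1 ?addr0; last first.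
  move=> m /andP[hm ne]; case: ifP => // hy.
  by case: (key _ m ht0 hr0 hb0 hm hy) => e _ _; rewrite e eqxx in ne.
rewrite /mask_weight big_seq_cond big_pred0 // => k; rewrite mem_iota add0n st nth_nseq.
by case: (k < N); rewrite ?andbF.
Qed.

Section Regular.
Variables (R : comPzRingType) (n : nat) (a : int -> R) (x : nat -> R).
Local Open Scope ring_scope.

Lemma bialternant lam : is_partition lam -> (size lam <= n)%N ->
  dschur n lam x a * alt n (facmon n a [::]) x = alt n (facmon n a lam) x.
Proof.
move=> hlam hn; rewrite dschurE // tabsum_mul_alt //.
rewrite -(sum_LRformula a (n := n) (mu := [::]) (fun q => alt n (facmon n a q) x)) //.
rewrite (bigD1_seq lam) ?uniq_parts_upto //=; last by rewrite mem_parts_upto hlam hn leq_addr.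
rewrite LRformula_empty // eqxx mul1r big_seq_cond big1 ?addr0 // => nu.
by rewrite mem_parts_upto => /andP[/and3P[h _ _] ne]; rewrite LRformula_empty // (negbTE ne) mul0r.
Qed.

(** The bialternant formula absorbs [s_mu] into the alternant of [mu]; [s_lam] then acts by walks
    from [mu], and each resulting alternant is turned back into [s_nu]. *)
Lemma dschur_mul_alt lam mu : is_partition lam -> is_partition mu ->
  (size lam <= n)%N -> (size mu <= n)%N ->
  alt n (facmon n a [::]) x * (dschur n lam x a * dschur n mu x a) =
  alt n (facmon n a [::]) x *
    \sum_(nu <- parts_upto n (sumn lam + sumn mu)) LRformula lam mu nu a * dschur n nu x a.
Proof.
move=> hlam hmu hl hm; rewrite mulrC -mulrA bialternant // dschurE // tabsum_mul_alt //.
rewrite -sum_LRformula // mulr_sumr big_seq [RHS]big_seq; apply: eq_bigr => nu.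
by rewrite mem_parts_upto => /and3P[h1 h2 _]; rewrite mulrCA [_ * dschur _ _ _ _]mulrC bialternant.
Qed.

End Regular.

(** * Change of coefficient ring *)

Section Transfer.
Variables (R S : comPzRingType) (f : {rmorphism S -> R}).
Local Open Scope ring_scope.

Lemma rmorph_dschur n p (x : nat -> S) a :
  f (dschur n p x a) = dschur n p (f \o x) (f \o a).
Proof.
rewrite rmorph_sum; apply: eq_bigr => t _; rewrite rmorph_prod.
by apply: eq_bigr => b _; rewrite rmorphB.
Qed.

Lemma rmorph_LRformula lam mu nu (a : int -> S) :
  f (LRformula lam mu nu a) = LRformula lam mu nu (f \o a).
Proof.
rewrite /LRformula; case: ifP => _; last exact: rmorph0.
rewrite rmorph_sum; apply: eq_bigr => r _; rewrite rmorph_sum; apply: eq_bigr => t _.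
rewrite rmorph_sum; apply: eq_bigr => m _; rewrite rmorph_prod; apply: eq_bigr => k _.
by rewrite rmorphB.
Qed.

Lemma eq_dschur n p (x y : nat -> R) a b : x =1 y -> a =1 b ->
  dschur n p x a = dschur n p y b.
Proof.
move=> ex ea; apply: eq_bigr => t _; apply: eq_bigr => c _.
by rewrite ex ea.
Qed.

Lemma eq_LRformula lam mu nu (a b : int -> R) : a =1 b ->
  LRformula lam mu nu a = LRformula lam mu nu b.
Proof.
move=> ea; rewrite /LRformula; case: ifP => _ //.
do 3 (apply: eq_bigr => ? _); apply: eq_bigr => k _.
by rewrite /= !ea.
Qed.

End Transfer.

(* The variables [x_i] are perturbed to [x_i + X^(i+1)] in [R[X]], which makes
   the Vandermonde product regular. *)
Lemma dschur_mul_nz (R : comNzRingType) n lam mu (x : nat -> R) (a : int -> R) :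
  is_partition lam -> is_partition mu -> size lam <= n -> size mu <= n ->
  (dschur n lam x a * dschur n mu x a =
   \sum_(nu <- parts_upto n (sumn lam + sumn mu)) LRformula lam mu nu a * dschur n nu x a)%R.
Proof.
move=> hlam hmu hl hm; pose f : {rmorphism {poly R} -> R} := horner_eval (0%R : R).
pose x' i : {poly R} := ((x i)%:P + 'X^(i.+1))%R; pose a' i := (a i)%:P%R.
have ex : f \o x' =1 x by move=> i; rewrite /= /horner_eval !hornerE expr0n addr0.
have ea : f \o a' =1 a by move=> i; rewrite /= /horner_eval hornerC.
have reg : GRing.lreg (alt n (facmon n a' [::]) x').
  have [b ->] := alt_facmon_nil n a' x'.
  apply: lregM; first exact: lreg_sign.
  apply: (big_ind (@GRing.lreg _)) => [|u v|i _]; [exact: lreg1|exact: lregM|].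
  apply: (big_ind (@GRing.lreg _)) => [|u v|j hij]; [exact: lreg1|exact: lregM|].
  (* As [i < j], the power [X^(j+2)] dominates and the difference is monic. *)
  apply: lreg_lead.
  have -> : (x' j.+1 - x' i.+1 = 'X^(j.+2) + ((x j.+1)%:P - (x i.+1)%:P - 'X^(i.+2)))%R.
    by rewrite /x'; ring.
  rewrite lead_coefDl ?lead_coefXn; first exact: lreg1.
  rewrite size_polyXn ltnS (leq_trans (size_polyD _ _)) // size_polyN size_polyXn geq_max.
  apply/andP; split; last by lia.
  by rewrite -rmorphB /= (leq_trans (size_polyC_leq1 _)).
have := congr1 f (reg _ _ (dschur_mul_alt a' x' hlam hmu hl hm)).
rewrite rmorphM !rmorph_dschur !(eq_dschur n _ ex ea) => ->; rewrite rmorph_sum.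
apply: eq_bigr => nu _.
by rewrite rmorphM rmorph_dschur (eq_dschur n _ ex ea) rmorph_LRformula (eq_LRformula _ _ _ ea).
Qed.

Theorem theorem2p1 (n : nat) (lam mu : seq nat) :
  0 < n -> is_partition lam -> is_partition mu -> size lam <= n -> size mu <= n ->
  (* expansion s_lam s_mu = sum_nu c^nu_{lam mu}(a) s_nu, with c given by the
     formula, as a polynomial identity (checked in every commutative ring) *)
  (forall (R : comPzRingType) (a : int -> R) (x : nat -> R),
     (dschur n lam x a * dschur n mu x a =
      \sum_(nu <- parts_upto n (sumn lam + sumn mu))
         LRformula lam mu nu a * dschur n nu x a)%R)
  (* the formula vanishes for the partitions nu not in the finite index set *)
  /\ (forall (nu : seq nat), is_partition nu -> size nu <= n ->
        sumn lam + sumn mu < sumn nu ->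
        forall (R : comPzRingType) (a : int -> R), LRformula lam mu nu a = 0%R)
  (* every factor occurring satisfies rho(alpha)_{T(alpha)} > c(alpha) *)
  /\ (forall (nu : seq nat), is_partition nu -> size nu <= n -> subdiag mu nu ->
        forall (r : seq nat) (T : box -> nat) (m : seq bool),
        yam_ok mu nu r -> reverse_tab lam T -> nu_bounded lam nu T ->
        barred_ok lam r T m ->
        forall k, k < size (boxes lam) -> ~~ nth false m k ->
        (content (nth (0%N, 0%N) (boxes lam) k) <
         (part (rho_of mu r m k) (T (nth (0%N, 0%N) (boxes lam) k)))%:Z)%R).
Proof.
move=> _ hlam hmu hl hm; split; [|split].
(* The zero ring is treated apart, since the perturbation uses polynomials over a nonzero ring. *)
- move=> R a x; case: (eqVneq (1 : R)%R 0%R) => [e|hne].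
    by rewrite -[LHS]mul1r -[RHS]mul1r e !mul0r.
  pose R' : comNzRingType := HB.pack R (GRing.PzSemiRing_isNonZero.Build R hne).
  exact: (@dschur_mul_nz R' n lam mu x a).
(* At most one box is added per box of [lam], so no path from [mu] reaches so large a diagram. *)
- move=> nu hnu _ hs R a; rewrite LRformula_masks //.
  rewrite big_seq_cond big1 // => t /andP[]; rewrite mem_words => /andP[/eqP st _] _.
  rewrite big_seq big1 // => m _; case: ifP => // /path_size e.
  have := size_subseq (mask_subseq m t); rewrite st size_boxes // => hle.
  by move: hs; rewrite e addnC ltn_add2l ltnNge hle.
move=> nu hnu _ _ r T m hy hr hb /andP[/eqP sm /eqP e] k hk mk.
have {}e : mask m (map T (boxes lam)) = r by rewrite -map_mask.
subst r.
(* For the box [(i, j)] the row length is at least [j], which exceeds the content [j - i] because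
   [i >= 1]. *)
have /= := unbarred_bound hlam hr hnu sm hy hb hk mk.
rewrite rho_ofE ?size_map // /content.
have : nth (0, 0) (boxes lam) k \in boxes lam by rewrite mem_nth.
case: (nth _ _ k) => i j; rewrite mem_boxesE //= => /and3P[i0 _ _]; lia.
Qed.
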